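(* Let $\mathcal{A}\in\mathbb{R}^{n_1\times\cdots\times n_d}$ with $d\ge 2$, let $p\in\{1,\dots,d\}$ and $\varepsilon\ge 0$. Let $\mathcal{G}^{(1)},\dots,\mathcal{G}^{(d)}$ be the cores output by the sparse TT conversion procedure (described below) on $(\mathcal{A},p)$, and let $\mathcal{B}$ be the TT tensor output by the dynamic-tolerance TT-rounding procedure (described below) applied to these cores with parameters $\varepsilon$ and $p$. Then $\|\mathcal{A}-\mathcal{B}\|_F\le\varepsilon\|\mathcal{A}\|_F$.
   Context: TT format: cores $\mathcal{G}^{(k)}\in\mathbb{R}^{r_{k-1}\times n_k\times r_k}$, $r_0=r_d=1$, represent the tensor with entries $\mathcal{G}^{(1)}(:,i_1,:)\cdots\mathcal{G}^{(d)}(:,i_d,:)$. For a core $\mathcal{G}\in\mathbb{R}^{a\times n\times b}$: $\mathbf{L}(\mathcal{G})\in\mathbb{R}^{an\times b}$, $\mathbf{L}(\mathcal{G})_{(i-1)n+j,\,l}=\mathcal{G}(i,j,l)$; $\mathbf{R}(\mathcal{G})\in\mathbb{R}^{a\times nb}$, $\mathbf{R}(\mathcal{G})_{i,\,(j-1)b+l}=\mathcal{G}(i,j,l)$. A $p$-fiber of $\mathcal{A}$ is a vector $\mathcal{A}(i_1,\dots,i_{p-1},:,i_{p+1},\dots,i_d)\in\mathbb{R}^{n_p}$. $\operatorname{Depar}$: given $\mathbf{M}\in\mathbb{R}^{a\times b}$, process columns $j=1,\dots,b$ in order keeping an ordered list $K$ of kept columns: if $\mathbf{M}_{:,j}=cK_i$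 for some kept $K_i$ and scalar $c$ (first such $i$), set $T_{i,j}=c$; otherwise append $\mathbf{M}_{:,j}$ to $K$ and set $T_{|K|,j}=1$; other entries of $\mathbf{T}$ zero. Output $\mathbf{N}=[K_1\cdots K_\beta]$, $\mathbf{T}\in\mathbb{R}^{\beta\times b}$. Sparse TT conversion on $(\mathcal{A},p)$: enumerate nonzero $p$-fibers as $j=1,\dots,R$ with fixed indices $(i^{(j)}_1,\dots,i^{(j)}_{p-1},i^{(j)}_{p+1},\dots,i^{(j)}_d)$ and values $\mathbf{v}_j$. Initial TT with ranks $r_0=r_d=1$, $r_k=R$ otherwise: for $k\neq p$, $\mathcal{G}^{(k)}(a,i,b)=1$ if $i=i^{(j)}_k$, where $j=b$ if $k=1$, $j=a$ if $k=d$, and $a=b=j$ is required if $1<k<d$, else $0$; $\mathcal{G}^{(p)}(a,i,b)=\mathbf{v}_j(i)$ with $j$ by the same rule, else $0$. Then for $k=1,\dots,p-1$: $(\mathbf{N},\mathbf{T})=\operatorname{Depar}(\mathbf{L}(\mathcal{G}^{(k)}))$, replace $\mathcal{G}^{(k)}$ by the core with $\mathbf{L}$-unfolding $\mathbf{N}$, and each slice $\mathcal{G}^{(k+1)}(:,i,:)$ by $\mathbf{T}\mathcal{G}^{(k+1)}(:,i,:)$. Then for $k=d,\dots,p+1$: $(\mathbf{N},\mathbf{T})=\operatorname{Depar}(\mathbf{R}(\mathcal{G}^{(k)})^T)$, replace $\mathcal{G}^{(k)}$ by the core with $\mathbf{R}$-unfolding $\mathbf{N}^T$, and each slice $\mathcal{G}^{(k-1)}(:,i,:)$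 by $\mathcal{G}^{(k-1)}(:,i,:)\mathbf{T}^T$. The output cores represent $\mathcal{A}$ exactly. $\delta$-truncated SVD of $\mathbf{G}=\sum_i\sigma_i\mathbf{u}_i\mathbf{v}_i^T$ ($\sigma_1\ge\sigma_2\ge\cdots$): take the smallest $r$ with $\sum_{i>r}\sigma_i^2\le\delta^2$, $\mathbf{U}=[\mathbf{u}_1\cdots\mathbf{u}_r]$, $\boldsymbol{\Sigma}=\mathrm{diag}(\sigma_1,\dots,\sigma_r)$, $\mathbf{V}=[\mathbf{v}_1\cdots\mathbf{v}_r]$, error $\mathbf{E}=\mathbf{G}-\mathbf{U}\boldsymbol{\Sigma}\mathbf{V}^T$. Dynamic-tolerance TT-rounding with $(\varepsilon,p)$: set $\delta_{\mathrm{right}}=\frac{\sqrt{d-p}}{\sqrt{d-p}+\sqrt{p-1}}\varepsilon\|\mathcal{A}\|_F$ and $\delta_{\mathrm{left}}=\frac{\sqrt{p-1}}{\sqrt{d-p}+\sqrt{p-1}}\varepsilon\|\mathcal{A}\|_F$. (First SVD-sweep) for $k=p,\dots,d-1$: set $\delta_k=\delta_{\mathrm{right}}/\sqrt{d-k}$; compute the $\delta_k$-truncated SVD $\mathbf{L}(\mathcal{G}^{(k)})=\mathbf{U}\boldsymbol{\Sigma}\mathbf{V}^T+\mathbf{E}_k$; replace $\mathcal{G}^{(k)}$ by the core with $\mathbf{L}$-unfolding $\mathbf{U}$ and each slice $\mathcal{G}^{(k+1)}(:,i,:)$ by $\boldsymbol{\Sigma}\mathbf{V}^T\mathcal{G}^{(k+1)}(:,i,:)$;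 set $\delta_{\mathrm{right}}=\sqrt{\delta_{\mathrm{right}}^2-\|\mathbf{E}_k\|_F^2}$. (QR-sweep) for $k=d,\dots,p+1$: economic QR $\mathbf{R}(\mathcal{G}^{(k)})^T=\mathbf{Q}\mathbf{R}$; replace $\mathcal{G}^{(k)}$ by the core with $\mathbf{R}$-unfolding $\mathbf{Q}^T$ and each slice $\mathcal{G}^{(k-1)}(:,i,:)$ by $\mathcal{G}^{(k-1)}(:,i,:)\mathbf{R}^T$. (Second SVD-sweep) for $k=p,\dots,2$: set $\delta_{k-1}=\delta_{\mathrm{left}}/\sqrt{k-1}$; compute the $\delta_{k-1}$-truncated SVD $\mathbf{R}(\mathcal{G}^{(k)})^T=\mathbf{U}\boldsymbol{\Sigma}\mathbf{V}^T+\mathbf{E}_{k-1}$; replace $\mathcal{G}^{(k)}$ by the core with $\mathbf{R}$-unfolding $\mathbf{U}^T$ and each slice $\mathcal{G}^{(k-1)}(:,i,:)$ by $\mathcal{G}^{(k-1)}(:,i,:)\mathbf{V}\boldsymbol{\Sigma}$; set $\delta_{\mathrm{left}}=\sqrt{\delta_{\mathrm{left}}^2-\|\mathbf{E}_{k-1}\|_F^2}$. Return the resulting cores as the TT $\mathcal{B}$. *)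

(* Defs.v *)
From HB Require Import structures.
From mathcomp Require Import all_boot all_order all_algebra.
From mathcomp Require Import reals.
Set Implicit Arguments. Unset Strict Implicit. Unset Printing Implicit Defensive.
Import Order.TTheory GRing.Theory Num.Theory.
Local Open Scope ring_scope.

Section TT.
Variable R : realType.

Definition mget {m k} (M : 'M[R]_(m, k)) (x y : nat) : R :=
  match (insub x : option 'I_m), (insub y : option 'I_k) with
  | Some i, Some j => M i j
  | _, _ => 0
  end.

Definition fnorm {m k} (M : 'M[R]_(m, k)) : R :=
  Num.sqrt (\sum_(i < m) \sum_(j < k) M i j ^+ 2).

(* multi-indices (i_1,...,i_d), coordinate k (1-based) stored at ordinal k-1 *)
Definition midx (d : nat) (n : 'I_d -> nat) := {dffun forall k : 'I_d, 'I_(n k)}.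

Definition tnorm {d} {n : 'I_d -> nat} (A : midx n -> R) : R :=
  Num.sqrt (\sum_(x : midx n) A x ^+ 2).

(* 1-based coordinate i_k of a multi-index (0-based value), 0 if k out of range *)
Definition coord {d} {n : 'I_d -> nat} (x : midx n) (k : nat) : nat :=
  if (insub k.-1 : option 'I_d) is Some o then val (x o) else 0%N.

Definition dimk {d} (n : 'I_d -> nat) (k : nat) : nat :=
  if (insub k.-1 : option 'I_d) is Some o then n o else 0%N.

(* a core G in R^{c_l x c_n x c_r}; entries G(a,i,b) with 0-based indices *)
Record core := Core { c_l : nat; c_n : nat; c_r : nat; c_v : nat -> nat -> nat -> R }.

(* a TT: cores indexed 1..d *)
Definition TT := nat -> core.

Definition upd (G : TT) (k : nat) (C : core) : TT :=
  fun m => if m == k then C else G m.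

(* L- and R-unfoldings (0-based version of the paper's index formulas) *)
Definition Lmat (G : core) : 'M[R]_(c_l G * c_n G, c_r G) :=
  \matrix_(x, y) c_v G (x %/ c_n G) (x %% c_n G) y.
Definition Rmat (G : core) : 'M[R]_(c_l G, c_n G * c_r G) :=
  \matrix_(x, y) c_v G x (y %/ c_r G) (y %% c_r G).

Definition ofL (a n : nat) {b} (N : 'M[R]_(a * n, b)) : core :=
  Core a n b (fun i j l => if (j < n)%N then mget N (i * n + j) l else 0).
Definition ofR (a n b : nat) (M : 'M[R]_(a, n * b)) : core :=
  Core a n b (fun i j l => if (l < b)%N then mget M i (j * b + l) else 0).

Definition left_mul {be b} (T : 'M[R]_(be, b)) (G : core) : core :=
  Core be (c_n G) (c_r G) (fun i j l => \sum_(a < b) mget T i a * c_v G a j l).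
Definition right_mul {b be} (G : core) (T : 'M[R]_(b, be)) : core :=
  Core (c_l G) (c_n G) be (fun i j l => \sum_(a < b) c_v G i j a * mget T a l).

(* the tensor represented by a TT: entry G1(:,i1,:) ... Gd(:,id,:),
   the product of slices written out as the row-vector recursion *)
Fixpoint ttvec {d} {n : 'I_d -> nat} (G : TT) (x : midx n) (k : nat) : nat -> R :=
  match k with
  | 0 => fun a => (a == 0)%:R
  | k'.+1 => fun l => \sum_(a < c_l (G k)) ttvec G x k' a * c_v (G k) a (coord x k) l
  end.
Definition tt_eval {d} {n : 'I_d -> nat} (G : TT) (x : midx n) : R := ttvec G x d 0.

Inductive chain (S : Type) (step : nat -> S -> S -> Prop) : seq nat -> S -> S -> Prop :=
| ch_nil s : chain step [::] s s
| ch_cons k ks s s1 s2 : step k s s1 -> chain step ks s1 s2 -> chain step (k :: ks) s s2.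

Definition depar_step {a} (K : seq 'cV[R]_a) (v : 'cV[R]_a) (K' : seq 'cV[R]_a)
    (t : nat * R) : Prop :=
  (exists i c, (i < size K)%N /\ v = c *: nth 0 K i /\
     (forall i' c', (i' < i)%N -> v <> c' *: nth 0 K i') /\ K' = K /\ t = (i, c))
  \/ ((forall i c, (i < size K)%N -> v <> c *: nth 0 K i) /\
      K' = rcons K v /\ t = (size K, 1)).

Inductive depar_run {a} : seq 'cV[R]_a -> seq 'cV[R]_a -> seq 'cV[R]_a ->
    seq (nat * R) -> Prop :=
| dr_nil K : depar_run [::] K K [::]
| dr_cons v vs K K1 Kf t ts : depar_step K v K1 t -> depar_run vs K1 Kf ts ->
    depar_run (v :: vs) K Kf (t :: ts).

Definition Depar {a b} (M : 'M[R]_(a, b)) {be} (N : 'M[R]_(a, be)) (T : 'M[R]_(be, b))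
    : Prop :=
  exists Kf ts, depar_run [seq col j M | j <- enum 'I_b] [::] Kf ts /\
    size Kf = be /\
    N = \matrix_(x, y) (nth 0 Kf y) x ord0 /\
    T = \matrix_(x, y) (if (nth (0%N, 0) ts y).1 == x then (nth (0%N, 0) ts y).2 else 0).

Section Sparse.
Variables (d : nat) (n : 'I_d -> nat).

Definition same_fiber (p : nat) (x y : midx n) : Prop :=
  forall k : 'I_d, k.+1 != p -> x k = y k.

(* s enumerates the nonzero p-fibers of A, each one exactly once
   (a fiber is represented by any multi-index on it) *)
Definition fiber_enum (A : midx n -> R) (p : nat) (s : seq (midx n)) : Prop :=
  (forall x, x \in s -> exists y, same_fiber p x y /\ A y <> 0) /\
  (forall y, A y <> 0 -> exists x, x \in s /\ same_fiber p x y) /\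
  (forall j1 j2 x1 x2, onth s j1 = Some x1 -> onth s j2 = Some x2 ->
     same_fiber p x1 x2 -> j1 = j2).

Definition fibval (A : midx n -> R) (p : nat) (s : seq (midx n)) (j i : nat) : R :=
  match onth s j, (insub p.-1 : option 'I_d) with
  | Some x, Some o =>
      match (insub i : option 'I_(n o)) with
      | Some io => A (finfun (dfwith (fun k => x k) io) : midx n)
      | None => 0
      end
  | _, _ => 0
  end.

Definition init_core (A : midx n -> R) (p : nat) (s : seq (midx n)) (k : nat) : core :=
  let r := size s in
  let cl := if k == 1%N then 1%N else r in
  let cr := if k == d then 1%N else r in
  Core cl (dimk n k) cr (fun a i b =>
    if [&& (a < cl)%N, (b < cr)%N & (i < dimk n k)%N] then
      let j := if k == 1%N then b else a in
      if [|| k == 1%N, k == d | a == b] then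
        (if k == p then fibval A p s j i
         else if onth s j is Some x then (i == coord x k)%:R else 0)
      else 0
    else 0).

Definition sparse_lstep (k : nat) (G G' : TT) : Prop :=
  exists be (N : 'M[R]_(c_l (G k) * c_n (G k), be)) (T : 'M[R]_(be, c_r (G k))),
    Depar (Lmat (G k)) N T /\
    G' = upd (upd G k (ofL N)) k.+1 (left_mul T (G k.+1)).

Definition sparse_rstep (k : nat) (G G' : TT) : Prop :=
  exists be (N : 'M[R]_(c_n (G k) * c_r (G k), be)) (T : 'M[R]_(be, c_l (G k))),
    Depar (Rmat (G k))^T N T /\
    G' = upd (upd G k (ofR N^T)) k.-1 (right_mul (G k.-1) T^T).

Definition sparse_tt (A : midx n -> R) (p : nat) (G : TT) : Prop :=
  exists s, fiber_enum A p s /\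
    exists G1, chain sparse_lstep (iota 1 p.-1) (init_core A p s) G1 /\
               chain sparse_rstep (rev (iota p.+1 (d - p))) G1 G.

Definition tsvd (delta : R) {m c} (M : 'M[R]_(m, c)) {r}
    (U : 'M[R]_(m, r)) (S : 'M[R]_r) (V : 'M[R]_(c, r)) : Prop :=
  exists (U0 : 'M[R]_(m, minn m c)) (V0 : 'M[R]_(c, minn m c)) (sg : 'rV[R]_(minn m c)),
    U0^T *m U0 = 1%:M /\ V0^T *m V0 = 1%:M /\
    (forall i, 0 <= sg ord0 i) /\
    (forall i j : 'I_(minn m c), (i <= j)%N -> sg ord0 j <= sg ord0 i) /\
    M = U0 *m diag_mx sg *m V0^T /\
    (r <= minn m c)%N /\
    \sum_(i < minn m c | (r <= i)%N) sg ord0 i ^+ 2 <= delta ^+ 2 /\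
    (forall r', (r' < r)%N -> delta ^+ 2 < \sum_(i < minn m c | (r' <= i)%N) sg ord0 i ^+ 2) /\
    U = \matrix_(x, y) mget U0 x y /\
    V = \matrix_(x, y) mget V0 x y /\
    S = diag_mx (\row_(y < r) mget sg 0 y).

Definition econ_qr {m a} (M : 'M[R]_(m, a)) (Q : 'M[R]_(m, minn m a))
    (Rm : 'M[R]_(minn m a, a)) : Prop :=
  Q^T *m Q = 1%:M /\ (forall (i : 'I_(minn m a)) (j : 'I_a), (j < i)%N -> Rm i j = 0) /\ M = Q *m Rm.

Definition svd1_step (k : nat) (st st' : TT * R) : Prop :=
  let: (G, dr) := st in
  exists r (U : 'M[R]_(c_l (G k) * c_n (G k), r)) (S : 'M[R]_r) (V : 'M[R]_(c_r (G k), r)),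
    tsvd (dr / Num.sqrt (d - k)%:R) (Lmat (G k)) U S V /\
    st' = (upd (upd G k (ofL U)) k.+1 (left_mul (S *m V^T) (G k.+1)),
           Num.sqrt (dr ^+ 2 - fnorm (Lmat (G k) - U *m S *m V^T) ^+ 2)).

Definition qr_step (k : nat) (G G' : TT) : Prop :=
  exists (Q : 'M[R]_(c_n (G k) * c_r (G k), minn (c_n (G k) * c_r (G k)) (c_l (G k))))
         (Rm : 'M[R]_(minn (c_n (G k) * c_r (G k)) (c_l (G k)), c_l (G k))),
    econ_qr (Rmat (G k))^T Q Rm /\
    G' = upd (upd G k (ofR Q^T)) k.-1 (right_mul (G k.-1) Rm^T).

Definition svd2_step (k : nat) (st st' : TT * R) : Prop :=
  let: (G, dl) := st in
  exists r (U : 'M[R]_(c_n (G k) * c_r (G k), r)) (S : 'M[R]_r) (V : 'M[R]_(c_l (G k), r)),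
    tsvd (dl / Num.sqrt (k - 1)%:R) (Rmat (G k))^T U S V /\
    st' = (upd (upd G k (ofR U^T)) k.-1 (right_mul (G k.-1) (V *m S)),
           Num.sqrt (dl ^+ 2 - fnorm ((Rmat (G k))^T - U *m S *m V^T) ^+ 2)).

(* B is an output of the dynamic-tolerance TT-rounding of the TT G with (eps, p);
   ||A||_F is the norm of the tensor represented by G *)
Definition tt_round (eps : R) (p : nat) (G B : TT) : Prop :=
  let nA := tnorm (fun x : midx n => tt_eval G x) in
  let sr := Num.sqrt (d - p)%:R in
  let sl := Num.sqrt (p - 1)%:R in
  exists G1 d1 G2 d3,
    chain svd1_step (iota p (d - p)) (G, sr / (sr + sl) * eps * nA) (G1, d1) /\
    chain qr_step (rev (iota p.+1 (d - p))) G1 G2 /\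
    chain svd2_step (rev (iota 2 (p - 1))) (G2, sl / (sr + sl) * eps * nA) (B, d3).

End Sparse.
End TT.

(* Main.v *)
(** Call a family of functions of the multi-index orthonormal over a set [S] of
    coordinates when it depends on these coordinates only and its Gram matrix,
    summed over them, is the identity.  Contracting such a family with a core
    whose unfolding has orthonormal columns gives an orthonormal family over one
    more coordinate; hence, when the cores on both sides of [k] have orthonormal
    unfoldings, the map from core [k] to the represented tensor is an isometry.

    In the initial sparse TT the unfolded columns are standard basis vectors.
    Deparallelisation keeps the distinct ones, so after the conversion every
    core other than the [p]-th has an orthonormal unfolding and the TT still
    represents [A].

    Truncating core [k] during an SVD-sweep changes the tensor by an error of
    norm [||E_k||], orthogonal to every tensor whose interface up to [k] is
    the truncated one, and all later tensors of the sweep are of this kind.  By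
    Pythagoras the squared error of a sweep is the sum of the [||E_k||^2], which
    the update of the tolerance keeps below the square of its initial value.
    The QR-sweep restores orthonormality to the right of [p] without changing
    the tensor, and the triangle inequality adds the two tolerances up to
    [eps * ||A||]. *)

Require Import Defs.
From HB Require Import structures.
From mathcomp Require Import all_boot all_order all_algebra.
From mathcomp Require Import reals.
From mathcomp Require Import ring lra zify.
Import Order.TTheory GRing.Theory Num.Theory.
Set Implicit Arguments. Unset Strict Implicit. Unset Printing Implicit Defensive.
Local Open Scope ring_scope.

(* [all_algebra] shadows the multi-index coordinate by the one of [vector]. *)
Local Notation coord := Defs.coord.

(** * Orthonormal families over sets of coordinates *)

Section Families.
Variables (R : realType) (d : nat) (n : 'I_d -> nat).
Implicit Types (S T : pred 'I_d) (x y : midx n) (o : 'I_d).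

Definition midx_set x o (i : 'I_(n o)) : midx n := finfun (dfwith (fun k => x k) i).

Lemma midx_set_at x o (i : 'I_(n o)) : midx_set x i o = i.
Proof. by rewrite ffunE dfwith_in. Qed.

Lemma midx_set_out x o (i : 'I_(n o)) k : k != o -> midx_set x i k = x k.
Proof. by move=> ko; rewrite ffunE dfwith_out // eq_sym. Qed.

(** Exchanging the inserted value with the old coordinate [o] is an involution on pairs [(x, i)].
    Reindexing by it turns the double sum into one where [i] is free. *)
Lemma sum_midx_set o (F : midx n -> R) :
  \sum_(x : midx n) \sum_(i < n o) F (midx_set x i) = (n o)%:R * \sum_(x : midx n) F x.
Proof.
pose swap (q : midx n * 'I_(n o)) := (midx_set q.1 q.2, q.1 o).
have swapK : involutive swap.
  case=> x i; congr pair; last exact: midx_set_at.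
  apply/ffunP => k; case: (eqVneq k o) => [->|ko]; first by rewrite midx_set_at.
  by rewrite !midx_set_out.
rewrite pair_big /= (reindex_inj (inv_inj swapK)) /=.
rewrite (eq_bigr (fun q : midx n * 'I_(n o) => F q.1)) => [|[x i] _].
  rewrite -(pair_big predT predT (fun x (_ : 'I_(n o)) => F x)) /= mulr_sumr.
  by apply: eq_bigr => x _; rewrite sumr_const card_ord mulr_natl.
by congr F; apply: (congr1 fst (swapK (x, i))).
Qed.

Definition depends_on S (f : midx n -> R) :=
  forall x y, (forall i, S i -> x i = y i) -> f x = f y.

(** Resampling coordinate [o] by [sum_midx_set] leaves [g] fixed and averages [h], so the two
    factors separate. *)
Lemma sum_coord o (h : nat -> R) (g : midx n -> R) :
  depends_on (predC1 o) g ->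
  \sum_(x : midx n) h (x o) * g x = (n o)%:R^-1 * (\sum_(i < n o) h i)
    * \sum_(x : midx n) g x.
Proof.
(* An empty mode leaves no multi-index, so both sides are empty sums. *)
move=> dg; case: (posnP (n o)) => [n0|n_gt0].
  have e (x : midx n) : False by case: (x o) => i; rewrite n0.
  by rewrite big1 ?[X in _ * X]big1 ?mulr0 // => x; case: (e x).
have nz : (n o)%:R != 0 :> R by rewrite pnatr_eq0 -lt0n.
apply: (mulfI nz); rewrite -sum_midx_set !mulrA mulfV // mul1r mulr_sumr.
apply: eq_bigr => x _; rewrite mulr_suml; apply: eq_bigr => i _.
rewrite midx_set_at; congr (_ * _); apply: dg => k /= ko.
by rewrite midx_set_out.
Qed.

(* For [g] independent of the coordinates in [S], [weight S * \sum_x g x] is the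
   sum of [g] over the other coordinates; so [orthofam] says that the Gram matrix
   of [l], summed over the coordinates in [S], is the identity. *)
Definition weight S : R := \prod_(i | S i) (n i)%:R^-1.

Definition orthofam S (l : nat -> midx n -> R) (m : nat) :=
  (forall a, depends_on S (l a)) /\
  forall a b g, (a < m)%N -> (b < m)%N -> depends_on (predC S) g ->
    \sum_(x : midx n) l a x * l b x * g x = (a == b)%:R * weight S * \sum_(x : midx n) g x.

Lemma depends_on_coord S o (h : nat -> R) : S o -> depends_on S (fun x => h (x o)).
Proof. by move=> So x y /(_ o So) ->. Qed.

Lemma depends_onM S f g :
  depends_on S f -> depends_on S g -> depends_on S (fun x => f x * g x).
Proof. by move=> df dg x y e; rewrite (df x y e) (dg x y e). Qed.

Lemma depends_on_sum S m (f : 'I_m -> midx n -> R) :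
  (forall a, depends_on S (f a)) -> depends_on S (fun x => \sum_a f a x).
Proof. by move=> df x y e; apply: eq_bigr => a _; apply: df. Qed.

Lemma depends_onW S T f :
  (forall i, S i -> T i) -> depends_on S f -> depends_on T f.
Proof. by move=> ST df x y e; apply: df => i /ST /e. Qed.

Section Extension.
Variables (S : pred 'I_d) (l : nat -> midx n -> R) (m : nat) (o : 'I_d).
Hypotheses (lS : orthofam S l m) (oS : ~~ S o).

(** After expanding both contractions, everything but the two factors of [l] ignores the coordinates
    in [S], because [o] is outside [S]. Orthonormality of [l] kills the terms with distinct rank
    indices, and [sum_coord] integrates out coordinate [o] in the others. *)
Lemma orthofam_contract (C D : nat -> nat -> nat -> R) b b' (g : midx n -> R) :
  depends_on (predC (predU1 o S)) g ->
  \sum_(x : midx n) (\sum_(a < m) l a x * C a (x o) b) *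
         (\sum_(a < m) l a x * D a (x o) b') * g x =
  (\sum_(a < m) \sum_(i < n o) C a i b * D a i b') * (weight S * (n o)%:R^-1)
  * \sum_(x : midx n) g x.
Proof.
move=> dg; have dg' : depends_on (predC1 o) g.
  by apply: depends_onW dg => i /=; rewrite negb_or => /andP[].
under eq_bigr => x _.
  rewrite mulr_suml mulr_suml.
  under eq_bigr => a _ do rewrite mulr_sumr mulr_suml.
  over.
rewrite exchange_big !mulr_suml /=; apply: eq_bigr => a _.
rewrite exchange_big (bigD1 a) //= [X in _ + X]big1 => [|a' a'a].
  rewrite addr0.
  transitivity (\sum_(x : midx n) l a x * l a x * (C a (x o) b * D a (x o) b' * g x)).
    by apply: eq_bigr => x _; ring.
  rewrite (lS.2 a a) ?ltn_ord //; last first.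
    apply: depends_onM; last first.
      by apply: depends_onW dg => i /=; rewrite negb_or => /andP[].
    by apply: (@depends_on_coord _ _ (fun i => C a i b * D a i b')).
  rewrite (sum_coord (fun i => C a i b * D a i b')) // eqxx mul1r !mulrA.
  by congr (_ * _); rewrite mulrC mulrA.
transitivity (\sum_(x : midx n) l a x * l a' x * (C a (x o) b * D a' (x o) b' * g x)).
  by apply: eq_bigr => x _; ring.
rewrite (lS.2 a a') ?ltn_ord //; last first.
  apply: depends_onM; last first.
      by apply: depends_onW dg => i /=; rewrite negb_or => /andP[].
  by apply: (@depends_on_coord _ _ (fun i => C a i b * D a' i b')).
by rewrite val_eqE eq_sym (negbTE a'a) !mul0r.
Qed.

Lemma weightU1 : weight (predU1 o S) = weight S * (n o)%:R^-1.
Proof.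
rewrite /weight (bigD1 o) /= ?eqxx // mulrC; congr (_ * _).
apply: eq_bigl => i; case: (eqVneq i o) => [->|] /=;
  by rewrite ?(negbTE oS) ?andbF ?andbT.
Qed.

(** Inductive step for the interfaces. The hypothesis says that the unfolding of [C] with rows
    [(a, i)] and columns [b] has orthonormal columns. *)
Lemma orthofam_ext (C : nat -> nat -> nat -> R) m' :
  (forall b b', (b < m')%N -> (b' < m')%N ->
    \sum_(a < m) \sum_(i < n o) C a i b * C a i b' = (b == b')%:R) ->
  orthofam (predU1 o S) (fun b x => \sum_(a < m) l a x * C a (x o) b) m'.
Proof.
move=> oC; split=> [b|b b' g bm bm' dg].
  apply: depends_on_sum => a; apply: depends_onM.
    by apply: depends_onW (lS.1 a) => i /= ->; rewrite orbT.
  by apply: (@depends_on_coord _ _ (fun i => C a i b)); rewrite /= eqxx.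
by rewrite orthofam_contract // oC // weightU1.
Qed.

(** Orthogonality at the single core [o] suffices, whatever the functions [f] and [g] on the
    remaining coordinates are. *)
Lemma orthofam_orthogonal (E U : nat -> nat -> nat -> R) m1 m2
    (f g : nat -> midx n -> R) :
  (forall c b, (c < m1)%N -> (b < m2)%N ->
    \sum_(a < m) \sum_(i < n o) E a i c * U a i b = 0) ->
  (forall c, depends_on (predC (predU1 o S)) (f c)) ->
  (forall c, depends_on (predC (predU1 o S)) (g c)) ->
  \sum_(x : midx n) (\sum_(c < m1) (\sum_(a < m) l a x * E a (x o) c) * f c x) *
         (\sum_(b < m2) (\sum_(a < m) l a x * U a (x o) b) * g b x) = 0.
Proof.
move=> EU df dg.
under eq_bigr => x _.
  rewrite mulr_suml; under eq_bigr => c _ do rewrite mulr_sumr.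
  over.
rewrite exchange_big big1 //= => c _; rewrite exchange_big big1 //= => b _.
under eq_bigr => x _ do rewrite mulrACA.
by rewrite orthofam_contract ?EU ?mul0r //; apply: depends_onM.
Qed.

Lemma orthofam_isometry T (r : nat -> midx n -> R) m' (E : nat -> nat -> nat -> R) :
  orthofam T r m' -> T =1 predC (predU1 o S) -> (forall i, 0 < n i)%N ->
  \sum_(x : midx n) (\sum_(c < m') (\sum_(a < m) l a x * E a (x o) c) * r c x) ^+ 2 =
  \sum_(a < m) \sum_(i < n o) \sum_(c < m') E a i c ^+ 2.
Proof.
move=> rT TS n0.
(* The weights of all coordinates multiply to the inverse of the number of multi-indices; positive
   mode sizes make this inverse genuine. *)
have wn : (weight S * (n o)%:R^-1) * (weight T * \sum_(x : midx n) 1) = 1.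
  rewrite -weightU1 mulrA sumr_const card_dep_ffun foldrE big_map big_enum /=.
  rewrite natr_prod.
  rewrite (_ : weight (predU1 o S) * weight T = \prod_i (n i)%:R^-1); last first.
    by rewrite [RHS](bigID (predU1 o S)) /= /weight [in LHS](eq_bigl _ _ TS).
  rewrite -big_split big1 //= => i _.
  by rewrite card_ord mulVf // pnatr_eq0 -lt0n.
under eq_bigr => x _.
  rewrite expr2 mulr_suml; under eq_bigr => c _ do rewrite mulr_sumr.
  over.
rewrite exchange_big /=.
transitivity (\sum_(c < m') \sum_(a < m) \sum_(i < n o) E a i c ^+ 2); last first.
  by rewrite exchange_big; apply: eq_bigr => a _; rewrite exchange_big.
apply: eq_bigr => c _; rewrite exchange_big /=.
have dr c' : depends_on (predC (predU1 o S)) (r c').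
  by apply: depends_onW (rT.1 c') => i; rewrite TS.
have tot c' : (c' < m')%N -> \sum_(x : midx n) r c x * r c' x =
    (c == c' :> nat)%:R * weight T * \sum_(x : midx n) 1.
  move=> c'm; rewrite -(rT.2 _ _ (fun=> 1)) //.
  by apply: eq_bigr => x _; rewrite mulr1.
rewrite (bigD1 c) //= [X in _ + X]big1 => [|c' c'c].
  rewrite addr0; under eq_bigr => x _ do rewrite mulrACA.
  rewrite orthofam_contract; last exact: depends_onM.
  rewrite tot // eqxx mul1r -!mulrA (mulrA (weight S)) wn mulr1.
  by apply: eq_bigr => a _; apply: eq_bigr => i _; rewrite expr2.
under eq_bigr => x _ do rewrite mulrACA.
rewrite orthofam_contract; last exact: depends_onM.
by rewrite tot // val_eqE eq_sym (negbTE c'c) !(mul0r, mulr0).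
Qed.

(* One truncation step: [C] is the core at [o], [U *m P] its truncation, whose
   error is orthogonal to [U].  Everything computed from [U] afterwards stays
   in its range, whence Pythagoras. *)
Lemma truncation_pythagoras T (r g : nat -> midx n -> R) m1 m2
    (C U : nat -> nat -> nat -> R) (P : nat -> nat -> R) :
  let E a i c := C a i c - \sum_(b < m2) U a i b * P b c in
  orthofam T r m1 -> T =1 predC (predU1 o S) -> (forall i, 0 < n i)%N ->
  (forall c b, (c < m1)%N -> (b < m2)%N ->
    \sum_(a < m) \sum_(i < n o) E a i c * U a i b = 0) ->
  (forall c, depends_on T (g c)) ->
  let X x := \sum_(c < m1) (\sum_(a < m) l a x * C a (x o) c) * r c x in
  let X1 x := \sum_(b < m2) (\sum_(a < m) l a x * U a (x o) b)
                          * \sum_(c < m1) P b c * r c x in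
  let Y x := \sum_(b < m2) (\sum_(a < m) l a x * U a (x o) b) * g b x in
  \sum_(x : midx n) (X x - Y x) ^+ 2 =
  \sum_(a < m) \sum_(i < n o) \sum_(c < m1) E a i c ^+ 2
  + \sum_(x : midx n) (X1 x - Y x) ^+ 2.
Proof.
move=> E rT TS n0 EU dg X X1 Y.
have dT f : depends_on T f -> depends_on (predC (predU1 o S)) f.
  by apply: depends_onW => i; rewrite TS.
pose D x := \sum_(c < m1) (\sum_(a < m) l a x * E a (x o) c) * r c x.
have XD x : X x = D x + X1 x.
  rewrite /X /D /X1.
  have -> : \sum_(b < m2) (\sum_(a < m) l a x * U a (x o) b) *
      (\sum_(c < m1) P b c * r c x) =
     \sum_(c < m1) (\sum_(a < m) l a x * \sum_(b < m2) U a (x o) b * P b c) * r c x.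
    under eq_bigr => b _ do rewrite mulr_sumr.
    rewrite exchange_big; apply: eq_bigr => c _ /=.
    rewrite mulr_suml; under eq_bigr => b _ do rewrite mulrA.
    under [RHS]eq_bigr => a _ do rewrite mulr_sumr mulr_suml.
    rewrite [RHS]exchange_big; apply: eq_bigr => b _ /=; rewrite !mulr_suml.
    by apply: eq_bigr => a _; ring.
  rewrite -big_split; apply: eq_bigr => c _ /=; rewrite -mulrDl -big_split /=.
  by congr (_ * _); apply: eq_bigr => a _; rewrite -mulrDr subrK.
rewrite -(orthofam_isometry E rT TS n0) -/D.
have -> : \sum_(x : midx n) (X x - Y x) ^+ 2 =
    \sum_(x : midx n) D x ^+ 2 + \sum_(x : midx n) (X1 x - Y x) ^+ 2
    + 2 * \sum_(x : midx n) D x * (X1 x - Y x).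
  rewrite mulr_sumr -!big_split /=; apply: eq_bigr => x _; rewrite XD; ring.
(* The cross term vanishes: [X1 - Y] is again a contraction of [U] with functions of the coordinates
   in [T]. *)
rewrite [X in 2 * X](_ : _ = 0) ?mulr0 ?addr0 //.
rewrite -[RHS](@orthofam_orthogonal E U m1 m2 r
  (fun b x => \sum_(c < m1) P b c * r c x - g b x)) //.
- apply: eq_bigr => x _; congr (_ * _); rewrite /X1 /Y -sumrB.
  by apply: eq_bigr => b _; rewrite mulrBr.
- by move=> c; apply: dT; apply: rT.1.
- move=> b; apply: dT => x y e; congr (_ - _); last exact: dg.
  by apply: eq_bigr => c _; rewrite (rT.1 c x y e).
Qed.

End Extension.
End Families.

(** * Matrices indexed by natural numbers, truncated SVD *)

Section Matrices.
Variable R : realType.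

Lemma mgetE m k (M : 'M[R]_(m, k)) (i : 'I_m) (j : 'I_k) : mget M i j = M i j.
Proof. by rewrite /mget !valK. Qed.

Lemma mget_tr m k (M : 'M[R]_(m, k)) x y : mget M^T x y = mget M y x.
Proof.
by rewrite /mget; case: (insub x) => [i|]; case: (insub y) => [j|] //; rewrite mxE.
Qed.

Lemma mget_mul m k c (M : 'M[R]_(m, k)) (N : 'M_(k, c)) x y :
  mget (M *m N) x y = \sum_(z < k) mget M x z * mget N z y.
Proof.
case xm: (x < m)%N; last first.
  rewrite [LHS]/mget insubF // big1 // => z _.
  by rewrite [mget M _ _]/mget insubF ?mul0r.
case yc: (y < c)%N; last first.
  rewrite [LHS]/mget (insubT (fun x => x < m)%N xm) (insubF 'I_c yc) // big1 // => z _.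
  by rewrite [mget N _ _]/mget valK (insubF 'I_c yc) mulr0.
rewrite (mgetE (M *m N) (Ordinal xm) (Ordinal yc)) mxE.
by apply: eq_bigr => z _; rewrite -!mgetE.
Qed.

Lemma mgetB m k (M N : 'M[R]_(m, k)) x y : mget (M - N) x y = mget M x y - mget N x y.
Proof.
by rewrite /mget; case: (insub x : option 'I_m) => [i|];
  case: (insub y : option 'I_k) => [j|];
   rewrite ?subrr // !mxE.
Qed.

Lemma mget_id m x y : (x < m)%N -> mget (1%:M : 'M[R]_m) x y = (x == y)%:R.
Proof.
move=> xm; case ym: (y < m)%N.
  by rewrite (mgetE _ (Ordinal xm) (Ordinal ym)) mxE.
rewrite /mget (insubT (fun x => x < m)%N xm) (insubF 'I_m ym).
by case: eqVneq => // xy; rewrite -xy xm in ym.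
Qed.

Lemma sum_divmod m k (F : nat -> nat -> R) :
  \sum_(x < m * k) F (x %/ k)%N (x %% k)%N = \sum_(i < m) \sum_(j < k) F i j.
Proof.
case: k => [|k].
  by rewrite muln0 big_ord0 big1 // => i _; rewrite big_ord0.
elim: m => [|m IHm]; first by rewrite !big_ord0.
rewrite [RHS]big_ord_recr /= -IHm.
rewrite -!(big_mkord xpredT (fun x => F (x %/ k.+1)%N (x %% k.+1)%N)).
rewrite mulSn addnC (@big_cat_nat _ _ _ (m * k.+1)) ?leq_addr //=; congr (_ + _).
rewrite -{1}[(m * k.+1)%N]add0n big_addn addKn big_mkord.
by apply: eq_bigr => j _; rewrite addnC divnMDl // modnMDl divn_small ?modn_small ?addn0.
Qed.

Lemma sum_rows m k (F : nat -> R) :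
  \sum_(x < m * k) F x = \sum_(i < m) \sum_(j < k) F (i * k + j)%N.
Proof.
rewrite -(sum_divmod m k (fun i j => F (i * k + j)%N)).
by apply: eq_bigr => x _; rewrite -divn_eq.
Qed.

Lemma mget_gram m k c c' (M : 'M[R]_(m * k, c)) (N : 'M_(m * k, c')) y y' :
  \sum_(i < m) \sum_(j < k) mget M (i * k + j) y * mget N (i * k + j) y' =
  mget (M^T *m N) y y'.
Proof.
rewrite -(sum_rows m k (fun x => mget M x y * mget N x y')) mget_mul.
by apply: eq_bigr => z _; rewrite mget_tr.
Qed.

Lemma fnorm_sq m c (M : 'M[R]_(m, c)) : fnorm M ^+ 2 = \sum_i \sum_j M i j ^+ 2.
Proof. by rewrite sqr_sqrtr //; do 2!apply: sumr_ge0 => ? _; apply: sqr_ge0. Qed.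

Lemma fnorm_sq_tr m c (M : 'M[R]_(m, c)) : fnorm M ^+ 2 = \tr (M^T *m M).
Proof.
rewrite fnorm_sq exchange_big; apply: eq_bigr => j _ /=; rewrite mxE.
by apply: eq_bigr => i _; rewrite mxE expr2.
Qed.

Lemma fnorm_sq_rows m k c (M : 'M[R]_(m * k, c)) :
  fnorm M ^+ 2 = \sum_(i < m) \sum_(j < k) \sum_(y < c) mget M (i * k + j) y ^+ 2.
Proof.
rewrite fnorm_sq -(sum_rows m k (fun x => \sum_(y < c) mget M x y ^+ 2)).
by apply: eq_bigr => x _; apply: eq_bigr => y _; rewrite mgetE.
Qed.

Lemma pid_mx_trK q r : (r <= q)%N ->
  (pid_mx r : 'M[R]_(r, q)) *m (pid_mx r : 'M_(q, r)) = 1%:M.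
Proof. by move=> rq; rewrite mul_pid_mx minnn (minn_idPr rq) pid_mx_1. Qed.

(** Truncation is multiplication by the selector [J] of the first [r] columns, so everything reduces
    to the diagonal projector [Q = J J^T]. The conclusions are what the sweeps need from the SVD;
    the symmetry of [S] serves the right-to-left sweep, which absorbs [V S]. *)
Lemma tsvdP delta m c (M : 'M[R]_(m, c)) r (U : 'M_(m, r)) (S : 'M_r) (V : 'M_(c, r)) :
  tsvd delta M U S V ->
  [/\ U^T *m U = 1%:M, S^T = S, (M - U *m S *m V^T)^T *m U = 0 &
      fnorm (M - U *m S *m V^T) ^+ 2 <= delta ^+ 2].
Proof.
move=> [U0 [V0 [sg [U0U0 [V0V0 [_ [_ [defM [rq [tail [_ [-> [-> ->]]]]]]]]]]]]].
set q := minn m c in U0 V0 sg U0U0 V0V0 defM rq tail *.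
pose J : 'M[R]_(q, r) := pid_mx r; pose D := diag_mx sg.
have getJ k (W : 'M[R]_(k, q)) : \matrix_(x, y) mget W x y = W *m J.
  apply/matrixP => x y; rewrite !mxE.
  rewrite (bigD1 (widen_ord rq y)) //= big1 => [|z zy].
    by rewrite mxE /= eqxx ltn_ord mulr1 addr0 -mgetE.
  rewrite mxE (_ : (z == y :> nat) = false) ?mulr0 //.
  by apply: contraNF zy => /eqP zy; apply/eqP/val_inj.
have JJ : J^T *m J = 1%:M by rewrite tr_pid_mx pid_mx_trK.
have Dr : diag_mx (\row_(y < r) mget sg 0 y) = J^T *m D *m J.
  rewrite -getJ mul_mx_diag; apply/matrixP => x y.
  have := mgetE (\matrix_(i, j) (J^T i j * sg 0 j)) x (widen_ord rq y).
  rewrite !mxE /= => ->; have := mgetE sg ord0 (widen_ord rq y) => /= <-.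
  rewrite ltn_ord andbT eq_sym val_eqE.
  by case: eqVneq => [->|_]; rewrite ?mul1r ?mul0r ?mulr1n.
pose Q := J *m J^T.
have QJ : Q *m J = J by rewrite -mulmxA JJ mulmx1.
have QQ : Q *m Q = Q by rewrite /Q mulmxA QJ.
have defQ : Q = pid_mx r by rewrite /Q tr_pid_mx mul_pid_mx !minnn.
have DQ : Q *m D = D *m Q.
  rewrite defQ mul_mx_diag mul_diag_mx; apply/matrixP => x y; rewrite !mxE.
  by case: eqVneq => [/val_inj ->|]; rewrite ?mulr0 ?mul0r // mulrC.
pose D1 := diag_mx (\row_i (if (r <= i)%N then sg 0 i else 0)).
have QD : (1%:M - Q) *m D = D1.
  rewrite defQ mul_mx_diag; apply/matrixP => x y; rewrite !mxE -val_eqE.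
  case: eqVneq => [/val_inj ->|] /=; rewrite ?subrr ?mul0r // ltnNge.
  by case: (r <= y)%N; rewrite ?subr0 ?subrr ?mul0r ?mul1r.
rewrite !getJ Dr.
(* [Q] is idempotent and commutes with [D], so the truncation is [U0 Q D V0^T] and the error keeps
   only the discarded singular values. *)
have err : M - U0 *m J *m (J^T *m D *m J) *m (V0 *m J)^T = U0 *m D1 *m V0^T.
  rewrite -QD defM -/D trmx_mul mulmxBl mul1mx mulmxBr mulmxBl; congr (_ - _).
  by rewrite -{1}QQ -(mulmxA Q) DQ /Q !mulmxA.
have D1T : D1^T = D1 by rewrite tr_diag_mx.
have QT : Q^T = Q by rewrite trmx_mul trmxK.
split.
- by rewrite trmx_mul mulmxA -(mulmxA J^T) U0U0 mulmx1 JJ.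
- by rewrite !trmx_mul trmxK tr_diag_mx mulmxA.
- rewrite err !trmx_mul trmxK -!mulmxA (mulmxA U0^T) U0U0 mul1mx -QD trmx_mul.
  by rewrite -mulmxA linearB /= trmx1 QT mulmxBl mul1mx QJ subrr !mulmx0.
(* Cycling the trace cancels [U0] and [V0]; the squared error is the trace of [D1 D1], which is the
   tail sum of the truncation criterion. *)
rewrite err fnorm_sq_tr !trmx_mul trmxK mulmxA mxtrace_mulC !mulmxA V0V0 mul1mx.
rewrite D1T -(mulmxA D1) U0U0 mulmx1 mulmx_diag mxtrace_diag.
apply: le_trans tail; rewrite [leRHS]big_mkcond le_eqVlt.
apply/orP; left; apply/eqP.
by apply: eq_bigr => i _; rewrite !mxE; case: ifP; rewrite ?mul0r ?expr2.
Qed.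
End Matrices.

(** * Interfaces of a tensor train *)

Section Interfaces.
Variables (R : realType) (d : nat) (n : 'I_d -> nat).
Implicit Types (G : TT R) (x : midx n) (C : core R).

Lemma coord_ord x (o : 'I_d) : coord x o.+1 = x o.
Proof. by rewrite /coord /= valK. Qed.

Lemma dimk_ord (o : 'I_d) : dimk n o.+1 = n o.
Proof. by rewrite /dimk /= valK. Qed.

Lemma ltn_coord x k : (0 < k <= d)%N -> (coord x k < dimk n k)%N.
Proof.
case: k => // k /= kd; rewrite -[k]/(val (Ordinal kd)) coord_ord dimk_ord.
exact: ltn_ord.
Qed.

Lemma depends_on_coordn (S : pred 'I_d) k (h : nat -> R) :
  (forall o : 'I_d, o = k.-1 :> nat -> S o) -> depends_on S (fun x => h (coord x k)).
Proof.
move=> Sk x y e; rewrite /coord; case: insubP => // o _ ok.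
by rewrite e //; apply: Sk.
Qed.

Lemma orthofam_eq (S T : pred 'I_d) (l l' : nat -> midx n -> R) m :
  S =1 T -> (forall a x, l a x = l' a x) -> orthofam S l m -> orthofam T l' m.
Proof.
move=> ST ll' [dl ol]; split=> [a x y e|a b g am bm dg].
  by rewrite -!ll'; apply: dl => i Si; apply: e; rewrite -ST.
rewrite /weight -(eq_bigl _ _ ST) -/(weight R n S) -ol //; last first.
  by apply: depends_onW dg => i; rewrite /= ST.
by apply: eq_bigr => x _; rewrite !ll'.
Qed.

Definition wf G :=
  [/\ c_l (G 1%N) = 1%N, c_r (G d) = 1%N,
      forall k, (0 < k < d)%N -> c_r (G k) = c_l (G k.+1) &
      forall k, (0 < k <= d)%N -> c_n (G k) = dimk n k].

(* Mirror image of [ttvec]: the product of the slices of cores k+1, ..., k+m. *)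
Fixpoint rvec G x m k : nat -> R :=
  match m with
  | 0 => fun a => (a == 0%N)%:R
  | m'.+1 => fun a =>
      \sum_(b < c_r (G k.+1)) c_v (G k.+1) a (coord x k.+1) b * rvec G x m' k.+1 b
  end.

Lemma ttvecE G x k b : (0 < k)%N -> ttvec G x k b =
  \sum_(a < c_l (G k)) ttvec G x k.-1 a * c_v (G k) a (coord x k) b.
Proof. by case: k. Qed.

Lemma eq_ttvec G G' x k a :
  (forall j, (0 < j <= k)%N -> G j = G' j) -> ttvec G x k a = ttvec G' x k a.
Proof.
elim: k a => //= k IHk a e; rewrite e ?leqnn //.
by apply: eq_bigr => b _; rewrite IHk // => j /andP[j0 jk]; rewrite e // j0 ltnW.
Qed.

Lemma eq_rvec G G' x m k a :
  (forall j, (k < j)%N -> G j = G' j) -> rvec G x m k a = rvec G' x m k a.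
Proof.
elim: m k a => //= m IHm k a e; rewrite e //.
by apply: eq_bigr => b _; rewrite (IHm k.+1) // => j kj; rewrite e // ltnW.
Qed.

Lemma ttvec_depends G k a :
  depends_on (fun i : 'I_d => (i < k)%N) (fun x => ttvec G x k a).
Proof.
elim: k a => [|k IHk] a //=; apply: depends_on_sum => b; apply: depends_onM.
  by apply: depends_onW (IHk b) => i /= ik; rewrite ltnW.
by apply: (@depends_on_coordn _ k.+1 (fun i => c_v (G k.+1) b i a)) => o /= ->.
Qed.

Lemma rvec_depends G m k a :
  depends_on (fun i : 'I_d => (k <= i)%N) (fun x => rvec G x m k a).
Proof.
elim: m k a => [|m IHm] k a //=; apply: depends_on_sum => b; apply: depends_onM.
  by apply: (@depends_on_coordn _ k.+1 (fun i => c_v (G k.+1) a i b)) => o /= ->.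
by apply: depends_onW (IHm k.+1 b) => i /= ik; rewrite ltnW.
Qed.

(** Cuts the product of slices in front of core [k+1]. The induction starts at the right end; moving
    the cut by one core is an exchange of two sums. *)
Lemma eval_split G x k : wf G -> (k < d)%N ->
  tt_eval G x = \sum_(a < c_l (G k.+1)) ttvec G x k a * rvec G x (d - k) k a.
Proof.
move=> [_ rd lr _] kd; have [m md] : exists m, (k + m.+1)%N = d.
  by exists (d - k.+1)%N; lia.
have -> : (d - k)%N = m.+1 by lia.
elim: m k kd md => [|m IHm] k kd md.
  have dk : d = k.+1 by lia.
  transitivity (ttvec G x k.+1 0); first by congr ttvec.
  have rk : c_r (G k.+1) = 1%N by rewrite -dk.
  by apply: eq_bigr => a _; rewrite /= rk big_ord1 /= mulr1.
have k1d : (k.+1 < d)%N by lia.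
rewrite (IHm k.+1) ?addSnnS // -lr ?k1d //=.
under [RHS]eq_bigr => a _ do rewrite mulr_sumr.
rewrite exchange_big; apply: eq_bigr => b _ /=.
by rewrite mulr_suml; apply: eq_bigr => a _; rewrite mulrA.
Qed.

Lemma eval_core G x k : wf G -> (0 < k <= d)%N ->
  tt_eval G x = \sum_(c < c_r (G k)) ttvec G x k c * rvec G x (d - k) k c.
Proof.
case: k => // k wG /= kd; rewrite (@eval_split G x k) //.
have -> /= : (d - k)%N = (d - k.+1).+1 by lia.
under eq_bigr => a _ do rewrite mulr_sumr.
rewrite exchange_big; apply: eq_bigr => c _ /=.
by rewrite mulr_suml; apply: eq_bigr => a _; rewrite mulrA.
Qed.

(** Here core [k] is contracted with the right interface first, the shape in which right-to-left
    steps see the tensor. *)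
Lemma eval_core_r G x k : wf G -> (0 < k <= d)%N ->
  tt_eval G x = \sum_(a < c_l (G k))
    (\sum_(c < c_r (G k)) rvec G x (d - k) k c * c_v (G k) a (coord x k) c)
    * ttvec G x k.-1 a.
Proof.
case: k => // k wG /= kd; rewrite (@eval_split G x k) //.
have -> : (d - k)%N = (d - k.+1).+1 by lia.
apply: eq_bigr => a _ /=; rewrite mulrC; congr (_ * _).
by apply: eq_bigr => c _; rewrite mulrC.
Qed.

(** [lorth] and [rorth] express orthonormal columns of the L-unfolding and orthonormal rows of the
    R-unfolding entrywise, in the form of the hypothesis of [orthofam_ext]. *)
Definition lorth C := forall b b', (b < c_r C)%N -> (b' < c_r C)%N ->
  \sum_(a < c_l C) \sum_(i < c_n C) c_v C a i b * c_v C a i b' = (b == b')%:R.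

Definition rorth C := forall a a', (a < c_l C)%N -> (a' < c_l C)%N ->
  \sum_(b < c_r C) \sum_(i < c_n C) c_v C a i b * c_v C a' i b = (a == a')%:R.

(** Iterates [orthofam_ext] from the left end, where the family is the constant 1 over no
    coordinates. Giving the size as [c_l (G k.+1)] instead of [c_r (G k)] covers [k = 0]. *)
Lemma orthofam_ttvec G k : wf G -> (k < d)%N ->
  (forall j, (0 < j <= k)%N -> lorth (G j)) ->
  orthofam (fun i : 'I_d => (i < k)%N) (fun a x => ttvec G x k a) (c_l (G k.+1)).
Proof.
move=> wG; have [l1 _ lr cn] := wG; elim: k => [|k IHk] kd oG.
  split=> [a|a b g]; first exact: ttvec_depends.
  rewrite l1 !ltnS !leqn0 => /eqP -> /eqP -> _.
  rewrite /weight big_pred0 // !mul1r.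
  by apply: eq_bigr => x _; rewrite !mul1r.
have k'd := ltnW kd; pose o := Ordinal k'd.
have {}IHk : orthofam (fun i : 'I_d => (i < k)%N) (fun a x => ttvec G x k a) (c_l (G k.+1)).
  by apply: IHk => // j /andP[j0 jk]; apply: oG; rewrite j0 ltnW.
have ok : ~~ (o < k)%N by rewrite ltnn.
rewrite -lr //; apply: orthofam_eq (orthofam_ext (C := c_v (G k.+1)) IHk ok _)
  => [i|b x|b b' bm bm'].
- by rewrite /= ltnS (leq_eqVlt i).
- by rewrite /= -coord_ord.
- have := oG k.+1 _ b b' bm bm'; rewrite cn; last by rewrite /= ltnW.
  by rewrite (dimk_ord o) leqnn => ->.
Qed.

Lemma orthofam_rvec G k : wf G -> (0 < k <= d)%N ->
  (forall j, (k < j <= d)%N -> rorth (G j)) ->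
  orthofam (fun i : 'I_d => (k <= i)%N) (fun b x => rvec G x (d - k) k b) (c_r (G k)).
Proof.
move=> wG; have [_ rd lr cn] := wG; move: {2}(d - k)%N (erefl (d - k)%N) => m.
elim: m k => [|m IHm] k dk kd oG; rewrite dk.
  have kd' : k = d by lia.
  split=> [a|a b g]; first exact: (rvec_depends G 0).
  rewrite kd' rd !ltnS !leqn0 => /eqP -> /eqP -> _.
  rewrite /weight big_pred0 => [|i]; last by rewrite leqNgt ltn_ord.
  by rewrite !mul1r; apply: eq_bigr => x _; rewrite !mul1r.
have k'd : (k < d)%N by lia.
pose o := Ordinal k'd.
have {}IHm : orthofam (fun i : 'I_d => (k.+1 <= i)%N)
    (fun b x => rvec G x m k.+1 b) (c_r (G k.+1)).
  have <- : (d - k.+1)%N = m by lia.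
  apply: IHm => //; first lia.
  by move=> j /andP[kj jd]; apply: oG; rewrite jd ltnW.
have ok : ~~ (k < o)%N by rewrite ltnn.
rewrite lr ?k'd ?andbT; last by case/andP: kd.
apply: orthofam_eq (orthofam_ext (C := fun b i a => c_v (G k.+1) a i b) IHm ok _)
  => [i|b x|b b' bm bm'].
- by rewrite /= (leq_eqVlt k) eq_sym.
- by rewrite /= -coord_ord; apply: eq_bigr => a _; rewrite mulrC.
- have := oG k.+1 _ b b' bm bm'; rewrite cn //.
  by rewrite (dimk_ord o) ltnSn => ->.
Qed.

End Interfaces.

(** * Moving a factor to the neighbouring core *)

Section Steps.
Variables (R : realType) (d : nat) (n : 'I_d -> nat).
Implicit Types (G : TT R) (x : midx n) (C : core R).
Local Notation wf := (wf n).

Lemma mget_Lmat C a i b : (a < c_l C)%N -> (i < c_n C)%N -> (b < c_r C)%N ->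
  mget (Lmat C) (a * c_n C + i) b = c_v C a i b.
Proof.
move=> al ic br; have n0 : (0 < c_n C)%N by apply: leq_ltn_trans ic.
have lt : (a * c_n C + i < c_l C * c_n C)%N.
  by rewrite -ltn_divLR // divnMDl // divn_small ?addn0.
rewrite (mgetE (Lmat C) (Ordinal lt) (Ordinal br)) mxE /=.
by rewrite divnMDl // modnMDl divn_small ?modn_small ?addn0.
Qed.

Lemma mget_Rmat C a i b : (a < c_l C)%N -> (i < c_n C)%N -> (b < c_r C)%N ->
  mget (Rmat C)^T (i * c_r C + b) a = c_v C a i b.
Proof.
move=> al ic br; have n0 : (0 < c_r C)%N by apply: leq_ltn_trans br.
have lt : (i * c_r C + b < c_n C * c_r C)%N.
  by rewrite -ltn_divLR // divnMDl // divn_small ?addn0.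
rewrite mget_tr (mgetE (Rmat C) (Ordinal al) (Ordinal lt)) mxE /=.
by rewrite divnMDl // modnMDl divn_small ?modn_small ?addn0.
Qed.

Lemma lorth_ofL a m b (N : 'M[R]_(a * m, b)) : N^T *m N = 1%:M -> lorth (ofL N).
Proof.
move=> NN y y' yb yb'; rewrite -(mget_id R y' yb) -NN -mget_gram.
by apply: eq_bigr => i _; apply: eq_bigr => j _ /=; rewrite ltn_ord.
Qed.

Lemma rorth_ofR a m b (N : 'M[R]_(m * b, a)) : N^T *m N = 1%:M -> rorth (ofR N^T).
Proof.
move=> NN y y' yb yb'; rewrite -(mget_id R y' yb) -NN -mget_gram exchange_big.
by apply: eq_bigr => i _; apply: eq_bigr => j _ /=; rewrite ltn_ord !mget_tr.
Qed.

(** Common form of the left-to-right updates of the conversion and of the rounding: [N] stays in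
    core [k], [T] is absorbed by its neighbour. [rstep] plays the same role for the right-to-left
    sweeps, including the QR-sweep. *)
Definition lstep G k be (N : 'M[R]_(c_l (G k) * c_n (G k), be))
    (T : 'M[R]_(be, c_r (G k))) : TT R :=
  upd (upd G k (ofL N)) k.+1 (left_mul T (G k.+1)).

Definition rstep G k be (N : 'M[R]_(c_n (G k) * c_r (G k), be))
    (T : 'M[R]_(be, c_l (G k))) : TT R :=
  upd (upd G k (ofR N^T)) k.-1 (right_mul (G k.-1) T^T).

Section Left.
Variables (G : TT R) (k be : nat) (N : 'M[R]_(c_l (G k) * c_n (G k), be)).
Variable (T : 'M[R]_(be, c_r (G k))).
Hypotheses (wG : wf G) (kd : (0 < k < d)%N).
Let G' := lstep N T.

Lemma lstep_at : G' k = ofL N.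
Proof. by rewrite /G' /lstep /upd eqn_leq ltnn andbF eqxx. Qed.

Lemma lstep_next : G' k.+1 = left_mul T (G k.+1).
Proof. by rewrite /G' /lstep /upd eqxx. Qed.

Lemma lstep_out j : j != k -> j != k.+1 -> G' j = G j.
Proof. by rewrite /G' /lstep /upd => /negbTE -> /negbTE ->. Qed.

Lemma wf_lstep : wf G'.
Proof.
have [l1 rd lr cn] := wG.
have el j : j != k.+1 -> c_l (G' j) = c_l (G j).
  by rewrite /G' /lstep /upd => /negbTE ->; case: eqVneq => [->|].
have er j : j != k -> c_r (G' j) = c_r (G j).
  by rewrite /G' /lstep /upd => /negbTE ->; case: eqVneq => [->|].
have en j : c_n (G' j) = c_n (G j).
  by rewrite /G' /lstep /upd; case: eqVneq => [->|_] //; case: eqVneq => [->|].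
split=> [||j jd|j jd]; rewrite ?en ?cn //.
- by rewrite el //; lia.
- by rewrite er //; lia.
case: (eqVneq j k) => [->|jk]; first by rewrite lstep_at lstep_next.
by rewrite el ?er ?lr // eqSS.
Qed.

Lemma ttvec_lstep_at x b : ttvec G' x k b =
  \sum_(a < c_l (G k)) ttvec G x k.-1 a * mget N (a * c_n (G k) + coord x k) b.
Proof.
have [k0 k'd] := andP kd; have [_ _ _ cn] := wG.
rewrite ttvecE // lstep_at /=.
have -> : (coord x k < c_n (G k))%N.
  by rewrite cn ?ltn_coord // k0 ltnW.
apply: eq_bigr => a _; congr (_ * _); apply: eq_ttvec => j /andP[_ jk].
by apply: lstep_out; lia.
Qed.

Lemma rvec_lstep_at x b :
  rvec G' x (d - k) k b = \sum_(c < c_r (G k)) mget T b c * rvec G x (d - k) k c.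
Proof.
have -> /= : (d - k)%N = (d - k.+1).+1 by lia.
rewrite lstep_next /=.
under eq_bigr => e _ do rewrite mulr_suml.
rewrite exchange_big; apply: eq_bigr => c _; rewrite mulr_sumr; apply: eq_bigr => e _ /=.
rewrite mulrA; congr (_ * _ * _); apply: eq_rvec => j kj.
by apply: lstep_out; lia.
Qed.

(** No relation between [N T] and the old unfolding is assumed, so truncations are covered as well
    as exact factorisations. *)
Lemma eval_lstep x : tt_eval G' x =
  \sum_(b < be)
    (\sum_(a < c_l (G k)) ttvec G x k.-1 a * mget N (a * c_n (G k) + coord x k) b)
    * \sum_(c < c_r (G k)) mget T b c * rvec G x (d - k) k c.
Proof.
have kd' : (0 < k <= d)%N by lia.
rewrite (eval_core x wf_lstep kd') lstep_at /=.
by apply: eq_bigr => b _; rewrite ttvec_lstep_at rvec_lstep_at.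
Qed.

Lemma eval_lstep_exact x : N *m T = Lmat (G k) -> tt_eval G' x = tt_eval G x.
Proof.
move=> NT; have [k0 k'd] := andP kd; have [_ _ _ cn] := wG.
have ik : (coord x k < c_n (G k))%N by rewrite cn ?ltn_coord // k0 ltnW.
have kd' : (0 < k <= d)%N by lia.
rewrite eval_lstep (eval_core x wG kd').
under eq_bigr => b _ do rewrite mulr_sumr.
rewrite exchange_big; apply: eq_bigr => c _ /=.
under eq_bigr => b _ do rewrite mulrA.
rewrite -mulr_suml; congr (_ * _).
under eq_bigr => b _ do rewrite mulr_suml.
rewrite exchange_big ttvecE //; apply: eq_bigr => a _ /=.
rewrite -mget_Lmat // -NT mget_mul mulr_sumr.
by apply: eq_bigr => b _; rewrite mulrA.
Qed.

End Left.

Section Right.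
Variables (G : TT R) (k be : nat) (N : 'M[R]_(c_n (G k) * c_r (G k), be)).
Variable (T : 'M[R]_(be, c_l (G k))).
Hypotheses (wG : wf G) (kd : (1 < k <= d)%N).
Let G' := rstep N T.

Lemma rstep_at : G' k = ofR N^T.
Proof. by rewrite /G' /rstep /upd (_ : k == k.-1 = false) ?eqxx //; lia. Qed.

Lemma rstep_prev : G' k.-1 = right_mul (G k.-1) T^T.
Proof. by rewrite /G' /rstep /upd eqxx. Qed.

Lemma rstep_out j : j != k -> j != k.-1 -> G' j = G j.
Proof. by rewrite /G' /rstep /upd => /negbTE -> /negbTE ->. Qed.

Lemma wf_rstep : wf G'.
Proof.
have [l1 rd lr cn] := wG.
have el j : j != k -> c_l (G' j) = c_l (G j).
  by rewrite /G' /rstep /upd => /negbTE ->; case: eqVneq => [->|].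
have er j : j != k.-1 -> c_r (G' j) = c_r (G j).
  by rewrite /G' /rstep /upd => /negbTE ->; case: eqVneq => [->|].
have en j : c_n (G' j) = c_n (G j).
  by rewrite /G' /rstep /upd; case: eqVneq => [->|_] //; case: eqVneq => [->|].
split=> [||j jd|j jd]; rewrite ?en ?cn //.
- by rewrite el //; lia.
- by rewrite er //; lia.
case: (eqVneq j k.-1) => [->|jk].
  by rewrite prednK ?rstep_at ?rstep_prev //; lia.
by rewrite el ?er ?lr //; lia.
Qed.

Lemma rvec_rstep_at x a : rvec G' x (d - k.-1) k.-1 a =
  \sum_(c < c_r (G k)) rvec G x (d - k) k c * mget N (coord x k * c_r (G k) + c) a.
Proof.
have [_ _ _ cn] := wG.
have -> /= : (d - k.-1)%N = (d - k).+1 by lia.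
rewrite prednK; last by lia.
rewrite rstep_at /=; apply: eq_bigr => c _; rewrite ltn_ord mget_tr mulrC.
congr (_ * _); apply: eq_rvec => j kj.
by apply: rstep_out; lia.
Qed.

Lemma ttvec_rstep_at x b :
  ttvec G' x k.-1 b = \sum_(a < c_l (G k)) mget T b a * ttvec G x k.-1 a.
Proof.
have e : k.-1 = k.-2.+1 by lia.
rewrite e /= -e rstep_prev /=.
under eq_bigr => c _ do rewrite mulr_sumr.
rewrite exchange_big; apply: eq_bigr => a _; rewrite mulr_sumr; apply: eq_bigr => c _ /=.
rewrite mget_tr mulrA mulrC; congr (_ * (_ * _)); apply: eq_ttvec => j kj.
by apply: rstep_out; lia.
Qed.

Lemma eval_rstep x : tt_eval G' x =
  \sum_(b < be)
    (\sum_(c < c_r (G k)) rvec G x (d - k) k c * mget N (coord x k * c_r (G k) + c) b)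
    * \sum_(a < c_l (G k)) mget T b a * ttvec G x k.-1 a.
Proof.
rewrite (eval_split x wf_rstep (k := k.-1)); last by lia.
have -> : c_l (G' k.-1.+1) = be by rewrite prednK ?rstep_at //; lia.
by apply: eq_bigr => b _; rewrite ttvec_rstep_at rvec_rstep_at mulrC.
Qed.

Lemma eval_rstep_exact x : N *m T = (Rmat (G k))^T -> tt_eval G' x = tt_eval G x.
Proof.
move=> NT; have [_ _ _ cn] := wG.
have k0d : (0 < k <= d)%N by lia.
have ik : (coord x k < c_n (G k))%N by rewrite cn ?ltn_coord.
rewrite eval_rstep (eval_core_r x wG (k := k)) //.
under eq_bigr => b _ do rewrite mulr_sumr.
rewrite exchange_big; apply: eq_bigr => a _ /=.
under eq_bigr => b _ do rewrite mulrA.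
rewrite -mulr_suml; congr (_ * _).
under [LHS]eq_bigr => b _ do rewrite mulr_suml.
rewrite exchange_big; apply: eq_bigr => c _ /=.
rewrite -mget_Rmat // -NT mget_mul mulr_sumr.
by apply: eq_bigr => b _; rewrite mulrA.
Qed.

End Right.
End Steps.

(** * Sweeps of the rounding procedure *)

Lemma chain_nilE (T : Type) (step : nat -> T -> T -> Prop) s s' :
  chain step [::] s s' -> s' = s.
Proof. by move=> h; inversion h. Qed.

Lemma chain_consE (T : Type) (step : nat -> T -> T -> Prop) k ks s s' :
  chain step (k :: ks) s s' -> exists2 s1, step k s s1 & chain step ks s1 s'.
Proof. by move=> h; inversion h; exists s1. Qed.

Lemma rev_iotaS i m : rev (iota i m.+1) = (i + m)%N :: rev (iota i m).
Proof. by rewrite -addn1 iotaD rev_cat. Qed.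

Section Sweeps.
Variables (R : realType) (d : nat) (n : 'I_d -> nat).
Implicit Types (G : TT R) (x : midx n) (C : core R).
Local Notation wf := (wf n).

(** The tolerance of one step never exceeds the remaining tolerance of its sweep. *)
Lemma sqr_divr_sqrt_le (a : R) m : (0 < m)%N -> (a / Num.sqrt m%:R) ^+ 2 <= a ^+ 2.
Proof.
move=> m0; rewrite expr_div_n sqr_sqrtr ?ler0n //.
by rewrite ler_pdivrMr ?ltr0n // ler_peMr ?sqr_ge0 // ler1n.
Qed.

Hypothesis n_gt0 : forall i, (0 < n i)%N.

(** Induction on the number [m] of remaining steps, with core [k] as the orthogonality centre. That
    cores before [k] are kept is part of the conclusion: applied to the rest of the sweep, it shows
    that the final train still contains the truncated factor [U] at core [k], as Pythagoras
    requires. *)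
Lemma svd1_sweep m k G G1 dr d1 :
  (k + m)%N = d -> (0 < k)%N -> wf G ->
  (forall j, (0 < j < k)%N -> lorth (G j)) ->
  (forall j, (k < j <= d)%N -> rorth (G j)) ->
  chain (@svd1_step R d) (iota k m) (G, dr) (G1, d1) ->
  [/\ wf G1, forall j, (j < k)%N -> G1 j = G j &
      \sum_(x : midx n) (tt_eval G x - tt_eval G1 x) ^+ 2 <= dr ^+ 2].
Proof.
elim: m k G dr => [|m IHm] k G dr km k0 wG oL oR /=.
  move=> ch; case: (chain_nilE ch) => -> _; split=> //.
  by rewrite big1 ?sqr_ge0 // => x _; rewrite subrr expr0n.
move=> ch0; have [[G' dr'] [r [U [S [V [svd [eG' edr']]]]]] ch] := chain_consE ch0.
have kd : (0 < k < d)%N by lia.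
rewrite -/(lstep U (S *m V^T)) in eG'.
have [UU _ EU Ele] := tsvdP svd.
have wG' : wf G' by rewrite eG'; apply: wf_lstep.
have := IHm k.+1 G' dr' _ _ wG' _ _ ch; case=> //.
- by rewrite addSnnS.
- move=> j /andP[j0]; rewrite ltnS leq_eqVlt => /orP[/eqP ->|jk].
    by rewrite eG' lstep_at //; apply: lorth_ofL.
  by rewrite eG' lstep_out; [apply: oL; rewrite j0 | lia | lia].
- by move=> j jk; rewrite eG' lstep_out; [apply: oR; lia | lia | lia].
move=> wG1 G1G' bound; split=> [//|j jk|].
  by rewrite G1G' ?eG' ?lstep_out //; lia.
have kd' : (k.-1 < d)%N by lia.
pose o := Ordinal kd'.
have ok : o.+1 = k by rewrite /= prednK.
have cx (x : midx n) : coord x k = x o by rewrite -coord_ord ok.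
have cn : c_n (G k) = n o.
  have [_ _ _ ->] := wG; last by lia.
  by rewrite -{1}ok dimk_ord.
have fS : orthofam (fun i : 'I_d => (i < k.-1)%N)
    (fun a (x : midx n) => ttvec G x k.-1 a) (c_l (G k)).
  rewrite (_ : c_l (G k) = c_l (G k.-1.+1)); last by rewrite prednK.
  by apply: orthofam_ttvec => // j jk; apply: oL; lia.
have fT : orthofam (fun i : 'I_d => (k <= i)%N)
    (fun b (x : midx n) => rvec G x (d - k) k b) (c_r (G k)).
  by apply: orthofam_rvec => //; lia.
have oS : ~~ (o < k.-1)%N by rewrite ltnn.
pose P b c := mget (S *m V^T) b c.
pose W a i b := mget U (a * c_n (G k) + i) b.
have defE a i c : (a < c_l (G k))%N -> (i < c_n (G k))%N -> (c < c_r (G k))%N ->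
    c_v (G k) a i c - \sum_(b < r) W a i b * P b c =
    mget (Lmat (G k) - U *m S *m V^T) (a * c_n (G k) + i) c.
  by move=> al ic cr; rewrite mgetB mget_Lmat // -mulmxA mget_mul.
have tS : (fun i : 'I_d => (k <= i)%N) =1 predC (predU1 o (fun i : 'I_d => (i < k.-1)%N)).
  by move=> i /=; rewrite -val_eqE /=; lia.
have EW c b : (c < c_r (G k))%N -> (b < r)%N -> \sum_(a < c_l (G k)) \sum_(i < n o)
    (c_v (G k) a i c - \sum_(b < r) W a i b * P b c) * W a i b = 0.
  move=> cr br; rewrite -cn.
  under eq_bigr => a _ do under eq_bigr => i _ do rewrite defE ?ltn_ord //.
  by rewrite mget_gram EU /mget; case: insub => // ?; case: insub => // ?; rewrite mxE.
(* The tensors before the step, just after it and at the end of the sweep serve as [X], [X1] and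
   [Y]. *)
have := truncation_pythagoras fS oS (C := c_v (G k)) (U := W) (P := P)
  (g := fun b x => rvec G1 x (d - k) k b) fT tS n_gt0 EW
  (fun c => @rvec_depends R d n G1 (d - k) k c).
move=> /= pyth.
have XE x : tt_eval G x = \sum_(c < c_r (G k))
    (\sum_(a < c_l (G k)) ttvec G x k.-1 a * c_v (G k) a (x o) c) * rvec G x (d - k) k c.
  rewrite (eval_core x wG (k := k)); last by lia.
  by apply: eq_bigr => c _; rewrite ttvecE // -cx.
have X1E x : tt_eval G' x = \sum_(b < r)
    (\sum_(a < c_l (G k)) ttvec G x k.-1 a * W a (x o) b) *
    \sum_(c < c_r (G k)) P b c * rvec G x (d - k) k c.
  by rewrite eG' eval_lstep // -cx.
have YE x : tt_eval G1 x = \sum_(b < r)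
    (\sum_(a < c_l (G k)) ttvec G x k.-1 a * W a (x o) b) * rvec G1 x (d - k) k b.
  rewrite (eval_core x wG1 (k := k)); last by lia.
  have -> : c_r (G1 k) = r by rewrite G1G' // eG' lstep_at.
  apply: eq_bigr => b _; congr (_ * _).
  rewrite (@eq_ttvec R d n G1 G' x k b) => [|j jk]; last by apply: G1G'; lia.
  by rewrite eG' ttvec_lstep_at // -cx.
under eq_bigr => x _ do rewrite XE YE.
rewrite pyth; under [X in _ + X]eq_bigr => x _ do rewrite -X1E -YE.
have errE : \sum_(a < c_l (G k)) \sum_(i < n o) \sum_(c < c_r (G k))
   (c_v (G k) a i c - \sum_(b < r) W a i b * P b c) ^+ 2 =
    fnorm (Lmat (G k) - U *m S *m V^T) ^+ 2.
  rewrite fnorm_sq_rows -cn; apply: eq_bigr => a _; apply: eq_bigr => i _.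
  by apply: eq_bigr => c _; rewrite defE.
(* [Num.sqrt] is 0 on negative numbers, so the update subtracts squares exactly only because the
   error of the step is within the current tolerance. *)
rewrite errE; move: bound; rewrite edr' sqr_sqrtr; last first.
  rewrite subr_ge0; apply: le_trans Ele _; apply: sqr_divr_sqrt_le; lia.
by rewrite lerBrDl.
Qed.

(** Each QR factorisation is exact, so only the cores change: the orthonormal factor stays behind
    and the triangular one moves towards core [p]. *)
Lemma qr_sweep m p G G1 :
  (p + m <= d)%N -> (0 < p)%N -> wf G ->
  chain (@qr_step R) (rev (iota p.+1 m)) G G1 ->
  [/\ wf G1, forall x, tt_eval G1 x = tt_eval G x,
      forall j, (j < p)%N -> G1 j = G j, forall j, (p + m < j)%N -> G1 j = G j &
      forall j, (p < j <= p + m)%N -> rorth (G1 j)].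
Proof.
elim: m G => [|m IHm] G pm p0 wG.
  by move=> ch; rewrite (chain_nilE ch); split=> // j; lia.
rewrite rev_iotaS addSnnS => ch0.
have [G' [Q [Rm [[QQ [_ QR]] eG']]] ch] := chain_consE ch0.
set k := (p + m.+1)%N in Q Rm QQ QR eG' pm *.
rewrite -/(rstep Q Rm) in eG'.
have kd : (1 < k <= d)%N by lia.
have wG' : wf G' by rewrite eG'; apply: wf_rstep.
have := IHm G' _ p0 wG' ch; case; first by lia.
move=> wG1 ev lo hi ro; split=> // [x|j jp|j jk|j jk].
- by rewrite ev eG' eval_rstep_exact.
- by rewrite lo // eG' rstep_out //; lia.
- by rewrite hi ?eG' ?rstep_out //; lia.
case: (eqVneq j k) => [->|jk']; last by apply: ro; lia.
rewrite hi; last by rewrite /k; lia.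
by rewrite eG' (rstep_at _ _ kd) //; apply: rorth_ofR.
Qed.

(** Mirror image of [svd1_sweep]: with [m] steps left the centre is core [m+1], and the right
    interface is the one that stays fixed. *)
Lemma svd2_sweep m G G1 dl d1 :
  (m < d)%N -> wf G ->
  (forall j, (0 < j <= m)%N -> lorth (G j)) ->
  (forall j, (m.+1 < j <= d)%N -> rorth (G j)) ->
  chain (@svd2_step R) (rev (iota 2 m)) (G, dl) (G1, d1) ->
  [/\ wf G1, forall j, (m.+1 < j)%N -> G1 j = G j &
      \sum_(x : midx n) (tt_eval G x - tt_eval G1 x) ^+ 2 <= dl ^+ 2].
Proof.
elim: m G dl => [|m IHm] G dl md wG oL oR.
  move=> ch; case: (chain_nilE ch) => -> _; split=> //.
  by rewrite big1 ?sqr_ge0 // => x _; rewrite subrr expr0n.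
rewrite rev_iotaS => ch0.
have [[G' dl'] [r [U [S [V [svd [eG' edl']]]]]] ch] := chain_consE ch0.
set k := (2 + m)%N in U S V svd eG' edl' *.
have [UU SS EU Ele] := tsvdP svd.
have kd : (1 < k <= d)%N by rewrite /k; lia.
(* The absorbed factor [V S] is the transpose of [S V^T] because [S] is symmetric. *)
have {}eG' : G' = rstep U (S *m V^T) by rewrite /rstep trmx_mul trmxK SS.
have wG' : wf G' by rewrite eG'; apply: wf_rstep.
have := IHm G' dl' _ wG' _ _ ch; case=> //.
- by lia.
- by move=> j jm; rewrite eG' rstep_out; [apply: oL; lia | lia | lia].
- move=> j jm; case: (eqVneq j k) => [->|jk].
    by rewrite eG' (rstep_at _ _ kd) //; apply: rorth_ofR.
  by rewrite eG' rstep_out; [apply: oR; lia | lia | lia].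
move=> wG1 G1G' bound; split=> [//|j jk|].
  by rewrite G1G' ?eG' ?rstep_out //; lia.
have k0 : (0 < k)%N by lia.
have kd' : (k.-1 < d)%N by lia.
pose o := Ordinal kd'.
have cx (x : midx n) : coord x k = x o by rewrite -coord_ord.
have cn : c_n (G k) = n o.
  by have [_ _ _ ->] := wG; rewrite ?(dimk_ord n o).
have fT : orthofam (fun i : 'I_d => (i < k.-1)%N)
    (fun a (x : midx n) => ttvec G x k.-1 a) (c_l (G k)).
  rewrite (_ : c_l (G k) = c_l (G k.-1.+1)); last by rewrite prednK.
  by apply: orthofam_ttvec => // j jk; apply: oL; lia.
have fS : orthofam (fun i : 'I_d => (k <= i)%N)
    (fun b (x : midx n) => rvec G x (d - k) k b) (c_r (G k)).
  by apply: orthofam_rvec => //; lia.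
have oS : ~~ (k <= o)%N by rewrite ltnn.
pose P b c := mget (S *m V^T) b c.
pose W c i b := mget U (i * c_r (G k) + c) b.
(* Swapping the rank indices lets the right interface take the place of the family [l]. *)
pose C c i a := c_v (G k) a i c.
have defE c i a : (a < c_l (G k))%N -> (i < c_n (G k))%N -> (c < c_r (G k))%N ->
    C c i a - \sum_(b < r) W c i b * P b a =
    mget ((Rmat (G k))^T - U *m S *m V^T) (i * c_r (G k) + c) a.
  by move=> al ic cr; rewrite mgetB mget_Rmat // -mulmxA mget_mul.
have tT : (fun i : 'I_d => (i < k.-1)%N) =1 predC (predU1 o (fun i : 'I_d => (k <= i)%N)).
  by move=> i /=; rewrite -val_eqE /=; lia.
have EW a b : (a < c_l (G k))%N -> (b < r)%N -> \sum_(c < c_r (G k)) \sum_(i < n o)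
    (C c i a - \sum_(b < r) W c i b * P b a) * W c i b = 0.
  move=> cr br; rewrite -cn exchange_big.
  under eq_bigr => i _ do under eq_bigr => c _ do rewrite defE ?ltn_ord //.
  by rewrite mget_gram EU /mget; case: insub => // ?; case: insub => // ?; rewrite mxE.
have := truncation_pythagoras fS oS (C := C) (U := W) (P := P)
  (g := fun b x => ttvec G1 x k.-1 b) fT tT n_gt0 EW
  (fun c => @ttvec_depends R d n G1 k.-1 c).
move=> /= pyth.
have XE x : tt_eval G x = \sum_(a < c_l (G k))
    (\sum_(c < c_r (G k)) rvec G x (d - k) k c * C c (x o) a) * ttvec G x k.-1 a.
  by rewrite (eval_core_r x wG (k := k)) -?cx //; lia.
have X1E x : tt_eval G' x = \sum_(b < r)
    (\sum_(c < c_r (G k)) rvec G x (d - k) k c * W c (x o) b) *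
    \sum_(a < c_l (G k)) P b a * ttvec G x k.-1 a.
  by rewrite eG' eval_rstep // -cx.
have YE x : tt_eval G1 x = \sum_(b < r)
    (\sum_(c < c_r (G k)) rvec G x (d - k) k c * W c (x o) b) * ttvec G1 x k.-1 b.
  rewrite (eval_split x wG1 kd').
  have -> : c_l (G1 k.-1.+1) = r by rewrite prednK // (G1G' k) // eG' (rstep_at _ _ kd).
  apply: eq_bigr => b _; rewrite mulrC; congr (_ * _).
  rewrite (@eq_rvec R d n G1 G') => [|j jk]; last by apply: G1G'; lia.
  by rewrite eG' rvec_rstep_at // -cx.
under eq_bigr => x _ do rewrite XE YE.
rewrite pyth; under [X in _ + X]eq_bigr => x _ do rewrite -X1E -YE.
have errE : \sum_(c < c_r (G k)) \sum_(i < n o) \sum_(a < c_l (G k))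
   (C c i a - \sum_(b < r) W c i b * P b a) ^+ 2 =
    fnorm ((Rmat (G k))^T - U *m S *m V^T) ^+ 2.
  rewrite fnorm_sq_rows -cn exchange_big; apply: eq_bigr => i _; apply: eq_bigr => c _.
  by apply: eq_bigr => a _; rewrite defE.
rewrite errE; move: bound; rewrite edl' sqr_sqrtr; last first.
  rewrite subr_ge0; apply: le_trans Ele _; apply: sqr_divr_sqrt_le; lia.
by rewrite lerBrDl.
Qed.

End Sweeps.

(** * Deparallelisation and the initial sparse tensor train *)

Section Deparallelisation.
Variables (R : realType) (a : nat).
Implicit Types (K vs : seq 'cV[R]_a) (v : 'cV[R]_a).

(** Kept columns are only appended, so a recorded position still denotes the same column at the end
    of the run. *)
Lemma depar_run_factor vs K Kf ts : depar_run vs K Kf ts ->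
  (size K <= size Kf)%N /\ (forall i, (i < size K)%N -> nth 0 Kf i = nth 0 K i) /\
  forall j, (j < size vs)%N -> let t := nth (0%N, 0) ts j in
    (t.1 < size Kf)%N /\ nth 0 vs j = t.2 *: nth 0 Kf t.1.
Proof.
elim=> [|v ws K0 K1 K2 t us st _ [sz [pre fac]]] //.
have [szK1 preK1] : (size K0 <= size K1)%N /\
    forall i, (i < size K0)%N -> nth 0 K1 i = nth 0 K0 i.
  case: st => [[i [c [_ [_ [_ [-> _]]]]]]|[_ [-> _]]] //.
  by rewrite size_rcons leqnSn; split=> // i iK; rewrite nth_rcons iK.
split; first exact: leq_trans sz.
split=> [i iK|[|j] /= jw]; last exact: fac.
  by rewrite pre ?preK1 //; apply: leq_trans szK1.
case: st => [[i [c [iK [-> [_ [eK ->]]]]]]|[_ [eK ->]]] /=.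
  by rewrite -eK (leq_trans _ sz) ?eK // pre ?eK.
have K1s : (size K0 < size K1)%N by rewrite eK size_rcons.
by rewrite (leq_trans K1s) // pre // eK nth_rcons ltnn eqxx scale1r.
Qed.

Definition unit_vec v := exists e, v = delta_mx e 0.

Lemma unit_vec_scale v w c : unit_vec v -> unit_vec w -> v = c *: w -> c = 1.
Proof.
move=> [e ->] [f ->] /matrixP/(_ e 0); rewrite !mxE !eqxx /=.
by case: eqP; rewrite ?mulr1 ?mulr0 => _ // /eqP; rewrite oner_eq0.
Qed.

(** Parallel standard basis vectors are equal, so on such columns the procedure merely removes
    duplicates and every recorded scalar is 1. *)
Lemma depar_run_unit vs K Kf ts : depar_run vs K Kf ts ->
  uniq K -> {in K, forall v, unit_vec v} -> {in vs, forall v, unit_vec v} ->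
  [/\ uniq Kf, {in Kf, forall v, unit_vec v} &
      forall j, (j < size vs)%N -> (nth (0%N, 0) ts j).2 = 1].
Proof.
elim=> [|v ws K0 K1 K2 t us st _ IH] //= uK aK avs.
have uv : unit_vec v by apply: avs; rewrite mem_head.
have [uK1 aK1 t1] : [/\ uniq K1, {in K1, forall v, unit_vec v} & t.2 = 1].
  case: st => [[i [c [iK [vc [_ [-> ->]]]]]]|[new [-> ->]]].
    by split=> //=; apply: unit_vec_scale vc => //; apply/aK/mem_nth.
  split=> // [|w]; last by rewrite mem_rcons inE => /predU1P[->|/aK].
  rewrite rcons_uniq uK andbT; apply/negP => vK.
  have := new (index v K0) 1; rewrite index_mem => /(_ vK).
  by rewrite nth_index // scale1r.
have [|uK2 aK2 t2] := IH uK1 aK1; first by move=> w ww; apply: avs; rewrite inE ww orbT.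
by split=> // -[|j] // jw; apply: t2.
Qed.

(** Distinct standard basis vectors are orthonormal, which gives [N^T N = 1]. The map [f] sends a
    column to the position of its kept copy; that [T] is the 0/1 matrix of [f] carries the
    basis-vector property to the next core. *)
Lemma Depar_unit b (M : 'M[R]_(a, b)) be (N : 'M_(a, be)) (T : 'M_(be, b)) :
  (forall j, unit_vec (col j M)) -> Depar M N T ->
  [/\ N *m T = M, N^T *m N = 1%:M &
      exists2 f : nat -> nat, forall j, (j < b)%N -> (f j < be)%N &
        forall i j, (i < be)%N -> (j < b)%N -> mget T i j = (i == f j)%:R].
Proof.
move=> uM [Kf [ts [run [sz [-> ->]]]]].
have [_ [_ fac]] := depar_run_factor run.
have [|||uK aK t1] := depar_run_unit run => //.
  by move=> v /mapP[j _ ->].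
have szv : size [seq col j M | j <- enum 'I_b] = b by rewrite size_map size_enum_ord.
rewrite szv in fac t1.
have nthv (j : 'I_b) : nth 0 [seq col j M | j <- enum 'I_b] j = col j M.
  by rewrite (nth_map j) ?size_enum_ord // nth_ord_enum.
split.
- apply/matrixP => x j; have [lt /matrixP/(_ x 0)] := fac j (ltn_ord j).
  rewrite nthv !mxE => ->; rewrite sz in lt.
  rewrite (bigD1 (Ordinal lt)) //= big1 => [|y yt].
    by rewrite !mxE /= eqxx addr0 mulrC.
  rewrite !mxE; case: eqP => e; last by rewrite mulr0.
  by case/eqP: yt; apply: val_inj.
- apply/matrixP => y y'; rewrite !mxE.
  have [|e ye] := aK (nth 0 Kf y); first by rewrite mem_nth ?sz.
  have [|e' ye'] := aK (nth 0 Kf y'); first by rewrite mem_nth ?sz.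
  rewrite (bigD1 e) //= big1 => [|x xe]; last first.
    by rewrite !mxE ye mxE (negbTE xe) mul0r.
  rewrite !mxE ye ye' !mxE !eqxx mul1r addr0 andbT.
  rewrite -[y == y']val_eqE /= -(nth_uniq 0 _ _ uK) ?sz // ye ye'.
  case: eqVneq => [->|ee']; first by rewrite eqxx.
  case: eqP => // /matrixP/(_ e 0); rewrite !mxE !eqxx (negbTE ee') => /eqP.
  by rewrite oner_eq0.
exists (fun j => (nth (0%N, 0) ts j).1) => [j jb|i j ib jb].
  by have [] := fac j jb; rewrite sz.
rewrite (mgetE _ (Ordinal ib) (Ordinal jb)) mxE /= t1 // eq_sym.
by case: eqP.
Qed.

End Deparallelisation.

(** * Cores whose unfoldings consist of standard basis vectors *)

Section UnitCores.
Variable R : realType.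
Implicit Type C : core R.

Definition unit_cols C := forall b, (b < c_r C)%N ->
  exists a0 i0, [/\ (a0 < c_l C)%N, (i0 < c_n C)%N &
    forall a i, (a < c_l C)%N -> (i < c_n C)%N ->
      c_v C a i b = ((a == a0) && (i == i0))%:R].

Definition unit_rows C := forall a, (a < c_l C)%N ->
  exists b0 i0, [/\ (b0 < c_r C)%N, (i0 < c_n C)%N &
    forall b i, (b < c_r C)%N -> (i < c_n C)%N ->
      c_v C a i b = ((b == b0) && (i == i0))%:R].

Lemma eq_divmod m y q r : (r < m)%N ->
  (y == q * m + r)%N = (y %/ m == q)%N && (y %% m == r)%N.
Proof.
move=> rm; have m0 : (0 < m)%N by apply: leq_ltn_trans rm.
apply/eqP/andP => [->|[/eqP <- /eqP <-]]; last exact: divn_eq.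
by rewrite divnMDl // modnMDl divn_small // modn_small // addn0 !eqxx.
Qed.

Lemma unit_cols_Lmat C j : unit_cols C -> unit_vec (col j (Lmat C)).
Proof.
move=> /(_ j (ltn_ord j)) [a0 [i0 [a0l i0n uC]]].
have lt : (a0 * c_n C + i0 < c_l C * c_n C)%N by nia.
exists (Ordinal lt); apply/colP => x; rewrite !mxE eqxx andbT.
rewrite uC ?ltn_mod; [|by rewrite ltn_divLR //; lia|by lia].
by rewrite -val_eqE /= eq_divmod.
Qed.

Lemma unit_rows_Rmat C j : unit_rows C -> unit_vec (col j (Rmat C)^T).
Proof.
move=> /(_ j (ltn_ord j)) [b0 [i0 [b0r i0n uC]]].
have lt : (i0 * c_r C + b0 < c_n C * c_r C)%N by nia.
exists (Ordinal lt); apply/colP => x; rewrite !mxE eqxx andbT.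
rewrite uC ?ltn_mod; [|by lia|by rewrite ltn_divLR //; lia].
by rewrite -val_eqE /= eq_divmod // andbC.
Qed.

End UnitCores.

(** * The initial train represents the tensor *)

Section Sparse.
Variables (R : realType) (d : nat) (n : 'I_d -> nat) (A : midx n -> R) (p : nat).
Hypotheses (d2 : (1 < d)%N) (pd : (0 < p <= d)%N).
Implicit Types (G : TT R) (x : midx n) (C : core R).
Local Notation wf := (wf n).

Variable (s : seq (midx n)).
Local Notation init := (init_core A p s).

Definition fiber_coord j k := if onth s j is Some x then coord x k else 0%N.

Lemma onth_ltn j : (j < size s)%N -> exists2 x, x \in s & onth s j = Some x.
Proof.
elim: (s) j => [|y t IHt] [|j] //= js; first by exists y; rewrite ?mem_head.
by have [x xt ->] := IHt j js; exists x; rewrite // inE xt orbT.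
Qed.

Lemma fiber_coord_lt j k :
  (j < size s)%N -> (0 < k <= d)%N -> (fiber_coord j k < dimk n k)%N.
Proof. by move=> /onth_ltn[x _ e] kd; rewrite /fiber_coord e ltn_coord. Qed.

(** The initial train is a sum of rank-one tensors, one per fiber; this is the [k]-th factor of the
    [j]-th of them. *)
Definition term k j i : R :=
  if k == p then fibval A p s j i else (i == fiber_coord j k)%:R.

Lemma init_v k a i b : (a < c_l (init k))%N -> (b < c_r (init k))%N -> (i < dimk n k)%N ->
  c_v (init k) a i b =
  if [|| k == 1%N, k == d | a == b] then term k (if k == 1%N then b else a) i else 0.
Proof.
move=> al br ik; rewrite /= al br ik /=; case: ifP => // _.
rewrite /term; case: ifP => // _; rewrite /fiber_coord.
case: (k =P 1%N) => k1.
  have [|x _ ->] // := @onth_ltn b.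
  by move: br; rewrite /= k1; case: eqP => // d1; lia.
have [|x _ ->] // := @onth_ltn a.
by move: al; rewrite /=; case: eqP.
Qed.

Lemma wf_init : wf init.
Proof.
split=> [||k kd|k kd] //=; first by rewrite eqxx.
by rewrite !ifF //; lia.
Qed.

(** Middle cores are diagonal in the rank indices, so each [b] carries the partial product of its
    own fiber. *)
Lemma ttvec_init x k b : (0 < k < d)%N -> (b < size s)%N ->
  ttvec init x k b = \prod_(1 <= m < k.+1) term m b (coord x m).
Proof.
move=> kd bs; elim: k kd b bs => // -[|k] IHk kd b bs.
  rewrite big_nat1 ttvecE // big_ord1 [ttvec _ _ _ _]/= mul1r init_v //.
    by rewrite /= ifF //; lia.
  by apply: ltn_coord; lia.
rewrite big_nat_recr // -IHk //; last by lia.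
have k1 : (k.+2 == 1)%N = false by [].
have kD : (k.+2 == d)%N = false by lia.
have cb (a : nat) : (a < size s)%N -> c_v (init k.+2) a (coord x k.+2) b =
    if a == b then term k.+2 b (coord x k.+2) else 0.
  move=> asz; rewrite init_v /= ?k1 ?kD //=; last by apply: ltn_coord; lia.
  by case: eqP => // ->.
rewrite ttvecE //; under eq_bigr => a _ do rewrite cb ?ltn_ord //.
rewrite (bigD1 (Ordinal bs : 'I_(c_l (init k.+2)))) //= [X in _ + X]big1 => [|a ab].
  by rewrite eqxx addr0.
case: (nat_of_ord a =P b) => [e|_]; last by rewrite mulr0.
by case/eqP: ab; apply: val_inj.
Qed.

Lemma eval_init_sum x :
  tt_eval init x = \sum_(b < size s) \prod_(1 <= m < d.+1) term m b (coord x m).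
Proof.
have d1 : (d == 1)%N = false by lia.
rewrite /tt_eval ttvecE; last by lia.
rewrite (_ : c_l (init d) = size s); last by rewrite /= d1.
apply: eq_bigr => b _.
have bl : (b < c_l (init d))%N by rewrite /= d1.
have br : (0 < c_r (init d))%N by rewrite /= eqxx.
have cd : (coord x d < dimk n d)%N by apply: ltn_coord; lia.
rewrite init_v // eqxx orbT d1 big_nat_recr; last by lia.
congr (_ * _); rewrite ttvec_init //; last by lia.
by rewrite prednK //; lia.
Qed.

(** The 0/1 factors away from [p] test whether [x] lies on the fiber of [y]. If it does, the factor
    at [p] reads that fiber at the [p]-th coordinate of [x], which is [A x]. *)
Lemma term_prod x y b : onth s b = Some y ->
  \prod_(1 <= m < d.+1) term m b (coord x m) =
  if [forall k : 'I_d, (k.+1 != p) ==> (x k == y k)] then A x else 0.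
Proof.
move=> sb; rewrite big_add1 big_mkord /=.
have pd' : (p.-1 < d)%N by lia.
pose o := Ordinal pd'; have op : o.+1 = p by rewrite /= prednK //; lia.
have key (k : 'I_d) : (k.+1 != p) = (k != o) by rewrite -op eqSS.
rewrite (bigD1 o) // coord_ord /term op eqxx.
rewrite (eq_bigr (fun k : 'I_d => (x k == y k)%:R)) => [|k ko]; last first.
  by rewrite (negbTE (_ : k.+1 != p)) ?key // /fiber_coord sb !coord_ord.
have -> : fibval A p s b (x o) = A (midx_set y (x o)).
  rewrite /fibval sb; have -> : p.-1 = o by [].
  by rewrite valK /= valK.
rewrite /=; case: ifPn => [/forallP xy|/forallPn[k]].
  rewrite big1 => [|k /= ko]; last by have := xy k; rewrite key ko /= => ->.
  rewrite mulr1; congr A; apply/ffunP => k.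
  case: (eqVneq k o) => [->|ko]; first exact: midx_set_at.
  by rewrite midx_set_out //; have := xy k; rewrite key ko /= => /eqP.
rewrite negb_imply key => /andP[ko xy].
by rewrite (bigD1 k) //= (negbTE xy) mul0r mulr0.
Qed.

Lemma eval_init x : fiber_enum A p s -> tt_eval init x = A x.
Proof.
move=> [_ [cov inj]]; rewrite eval_init_sum.
pose f b := if onth s b is Some y then
  [forall k : 'I_d, (k.+1 != p) ==> (x k == y k)] else false.
under eq_bigr => b _.
  have [y _ sb] := onth_ltn (ltn_ord b).
  rewrite (term_prod x sb) (_ : [forall _, _] = f b); last by rewrite /f sb.
  over.
(* If [A x] is 0, every summand is 0 whether or not [x] lies on an enumerated fiber. Otherwise
   exactly one enumerated fiber contains [x]. *)
case: (eqVneq (A x) 0) => [->|Ax]; first by rewrite big1 // => b _; case: ifP.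
have [y [ys yx]] := cov x (elimN eqP Ax).
have [b bs sb] : exists2 b, (b < size s)%N & onth s b = Some y.
  by exists (index y s); rewrite ?index_mem // onthE (nth_map y) ?index_mem // nth_index.
have fb : f b.
  by rewrite /f sb; apply/forallP => k; apply/implyP => kp; rewrite (yx k kp).
rewrite (bigD1 (Ordinal bs)) //= fb big1 ?addr0 // => b' b'b.
case: ifP => // fb'; case/eqP: b'b; apply: val_inj => /=.
have [y' _ sb'] := onth_ltn (ltn_ord b').
apply: (inj _ _ _ _ sb' sb) => k kp; rewrite yx //.
move: fb'; rewrite /f sb' => /forallP/(_ k); rewrite kp => /eqP <- //.
Qed.

End Sparse.

(** * Sparse conversion and the error bound *)

Section SparseSweeps.
Variables (R : realType) (d : nat) (n : 'I_d -> nat) (A : midx n -> R) (p : nat).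
Hypotheses (d2 : (1 < d)%N) (pd : (0 < p <= d)%N).
Variable (s : seq (midx n)).
Implicit Types (G : TT R) (x : midx n) (C : core R).
Local Notation wf := (wf n).
Local Notation init := (init_core A p s).

Lemma init_mid k a i b : (1 < k < d)%N -> k != p ->
  (a < size s)%N -> (b < size s)%N -> (i < dimk n k)%N ->
  c_v (init k) a i b = ((a == b) && (i == fiber_coord s b k))%:R.
Proof.
move=> kd kp asz bsz ik.
have k1 : (k == 1%N) = false by lia.
have kD : (k == d) = false by lia.
rewrite init_v //; try by rewrite /= ?k1 ?kD.
rewrite k1 kD /= /term (negbTE kp).
by case: (eqVneq a b) => [->|].
Qed.

Lemma unit_cols_init1 : p != 1%N -> unit_cols (init 1).
Proof.
move=> p1 b br.
have bs : (b < size s)%N by move: br; rewrite /= ifF //; lia.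
exists 0%N, (fiber_coord s b 1); split=> //; first by rewrite /= fiber_coord_lt //; lia.
move=> a i al ik; have a0 : a = 0%N by move: al => /=; case: (a).
by rewrite init_v // a0 eqxx /term [1%N == p]eq_sym (negbTE p1).
Qed.

Lemma unit_rows_initd : p != d -> unit_rows (init d).
Proof.
move=> p1 a al; have d1 : (d == 1%N) = false by lia.
have asz : (a < size s)%N by move: al; rewrite /= d1.
exists 0%N, (fiber_coord s a d); split; first by rewrite /= eqxx.
  by rewrite /= fiber_coord_lt //; lia.
move=> b i bl ik; have b0 : b = 0%N by move: bl; rewrite /= eqxx; lia.
rewrite init_v //.
by rewrite d1 eqxx b0 eqxx /term [d == p]eq_sym (negbTE p1).
Qed.

(** The invariant is that the current core has basis-vector columns. It is required only while steps
    remain, since core [p] holds the values of the fibers. *)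
Lemma sparse_left_sweep m k G G1 :
  (k + m)%N = p -> (0 < k)%N -> wf G ->
  (forall j, (0 < j < k)%N -> lorth (G j)) ->
  ((0 < m)%N -> unit_cols (G k)) ->
  (forall j, (k < j)%N -> G j = init j) ->
  chain (@sparse_lstep R) (iota k m) G G1 ->
  [/\ wf G1, forall x, tt_eval G1 x = tt_eval G x,
      forall j, (0 < j < p)%N -> lorth (G1 j) &
      forall j, (p < j)%N -> G1 j = init j].
Proof.
elim: m k G => [|m IHm] k G km k0 wG oL uc Gi.
  move=> ch; rewrite (chain_nilE ch); split=> // j jp; [apply: oL|apply: Gi]; lia.
move=> ch0; have [G' [be [N [T [dep eG']]]] ch] := chain_consE ch0.
have {}eG' : G' = lstep N T by [].
have kd : (0 < k < d)%N by lia.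
have [NT NN [f fb Tf]] := Depar_unit (fun j => unit_cols_Lmat j (uc isT)) dep.
have wG' : wf G' by rewrite eG'; apply: wf_lstep.
have := IHm k.+1 G' _ _ wG' _ _ _ ch; case=> //.
- by rewrite addSnnS.
- move=> j jk; case: (eqVneq j k) => [->|jk'].
    by rewrite eG' lstep_at; apply: lorth_ofL.
  by rewrite eG' lstep_out; [apply: oL; lia | lia | lia].
- move=> m0; rewrite eG' lstep_next (Gi k.+1) // => b br.
  have kp : (1 < k.+1 < d)%N by lia.
  have kp' : k.+1 != p by lia.
  have bs : (b < size s)%N by move: br; rewrite /= ifF //; lia.
  have ck : c_r (G k) = size s.
    have [_ _ -> //] := wG; rewrite Gi //= ifF //; lia.
  (* The next core is still an initial one, diagonal in its ranks, so multiplying by [T] only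
     relabels the left rank index [b] as [f b]. *)
  exists (f b), (fiber_coord s b k.+1); split.
  + by apply: fb; rewrite ck.
  + by rewrite /= fiber_coord_lt //; lia.
  move=> a i al ik /=.
  have bk : (b < c_r (G k))%N by rewrite ck.
  under eq_bigr => c _.
    have cs' : (c < size s)%N by rewrite -ck.
    rewrite -/(init k.+1) -[X in _ * X]/(c_v (init k.+1) c i b) init_mid //.
    over.
  rewrite (bigD1 (Ordinal bk)) //= [X in _ + X]big1 => [|c cb].
    by rewrite addr0 eqxx /= Tf // -natrM mulnb.
  by rewrite [c == b :> nat](negbTE cb) mulr0.
- by move=> j jk; rewrite eG' lstep_out ?Gi //; lia.
move=> wG1 ev lo hi; split=> // x.
by rewrite ev eG' eval_lstep_exact.
Qed.

(** Only cores strictly between [p] and [p + m] must be initial ones: core [p] may have absorbed a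
    factor of the left sweep, and core [p + m] one of the previous right step. *)
Lemma sparse_right_sweep m G G1 :
  (p + m <= d)%N -> wf G ->
  (forall j, (p + m < j <= d)%N -> rorth (G j)) ->
  ((0 < m)%N -> unit_rows (G (p + m)%N)) ->
  (forall j, (p < j < p + m)%N -> G j = init j) ->
  chain (@sparse_rstep R) (rev (iota p.+1 m)) G G1 ->
  [/\ wf G1, forall x, tt_eval G1 x = tt_eval G x,
      forall j, (j < p)%N -> G1 j = G j &
      forall j, (p < j <= d)%N -> rorth (G1 j)].
Proof.
elim: m G => [|m IHm] G pmd wG oR ur Gi.
  move=> ch; rewrite (chain_nilE ch); split=> // j jp; apply: oR; lia.
rewrite rev_iotaS addSnnS => ch0; have [G' [be [N [T [dep eG']]]] ch] := chain_consE ch0.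
set k := (p + m.+1)%N in N T dep eG' pmd oR ur Gi.
have {}eG' : G' = rstep N T by [].
have kd : (1 < k <= d)%N by lia.
have [NT NN [f fb Tf]] := Depar_unit (fun j => unit_rows_Rmat j (ur isT)) dep.
have wG' : wf G' by rewrite eG'; apply: wf_rstep.
have := IHm G' _ wG' _ _ _ ch; case=> //.
- by lia.
- move=> j jk; case: (eqVneq j k) => [->|jk'].
    by rewrite eG' (rstep_at _ _ kd); apply: rorth_ofR.
  by rewrite eG' rstep_out; [apply: oR; lia | lia | lia].
- move=> m0; rewrite (_ : (p + m)%N = k.-1); last by rewrite /k; lia.
  have kp : (1 < k.-1 < d)%N by rewrite /k; lia.
  have kp' : k.-1 != p by rewrite /k; lia.
  rewrite eG' rstep_prev (Gi k.-1); last by rewrite /k; lia.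
  move=> b br; have bs : (b < size s)%N by move: br; rewrite /= ifF //; lia.
  have ck : c_l (G k) = size s.
    have [_ _ lr _] := wG; have := lr k.-1; rewrite prednK; last by lia.
    move=> <-; last by lia.
    rewrite Gi //= ?ifF //; rewrite /k; lia.
  exists (f b), (fiber_coord s b k.-1); split.
  + by apply: fb; rewrite ck.
  + by rewrite /= fiber_coord_lt //; lia.
  move=> a i al ik /=.
  have bk : (b < c_l (G k))%N by rewrite ck.
  under eq_bigr => c _.
    have cs' : (c < size s)%N by rewrite -ck.
    rewrite -[X in X * _]/(c_v (init k.-1) b i c) init_mid // mget_tr.
    over.
  rewrite (bigD1 (Ordinal bk)) //= [X in _ + X]big1 => [|c cb].
    by rewrite addr0 eqxx /= Tf // -natrM mulnb andbC.
  by rewrite eq_sym [c == b :> nat](negbTE cb) mul0r.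
- by move=> j jk; rewrite eG' rstep_out ?Gi //; lia.
move=> wG1 ev lo hi; split=> // [x|j jp].
  by rewrite ev eG' eval_rstep_exact.
by rewrite lo // eG' rstep_out //; lia.
Qed.

End SparseSweeps.

(** The converted train has its orthogonality centre at core [p], so the first SVD-sweep can start
    there at once. *)
Lemma sparse_ttP (R : realType) (d : nat) (n : 'I_d -> nat) (A : midx n -> R) (p : nat)
    (G : TT R) :
  (1 < d)%N -> (0 < p <= d)%N -> sparse_tt A p G ->
  [/\ wf n G, forall x : midx n, tt_eval G x = A x,
      forall j, (0 < j < p)%N -> lorth (G j) &
      forall j, (p < j <= d)%N -> rorth (G j)].
Proof.
move=> d2 pd [s [fs [G1 [chl chr]]]].
have [wG1 ev1 lo1 hi1] : [/\ wf n G1,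
    forall x : midx n, tt_eval G1 x = tt_eval (init_core A p s) x,
    forall j, (0 < j < p)%N -> lorth (G1 j) &
    forall j, (p < j)%N -> G1 j = init_core A p s j].
  apply: (sparse_left_sweep d2 pd _ (ltn0Sn 0) (wf_init A d2 pd s) _ _ _ chl) => //.
  - by rewrite add1n prednK //; lia.
  - by move=> j; lia.
  - by move=> p1; apply: unit_cols_init1 => //; lia.
have pm : (p + (d - p))%N = d by lia.
have [wG ev lo hi] : [/\ wf n G, forall x : midx n, tt_eval G x = tt_eval G1 x,
    forall j, (j < p)%N -> G j = G1 j & forall j, (p < j <= d)%N -> rorth (G j)].
  apply: (sparse_right_sweep d2 pd (s := s) _ wG1 _ _ _ chr).
  - by rewrite pm.
  - by move=> j; rewrite pm; lia.
  - move=> p1; rewrite pm hi1; last by lia.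
    by apply: unit_rows_initd => //; lia.
  - by move=> j jp; apply: hi1; lia.
split=> // [x|j jp]; first by rewrite ev ev1 eval_init.
by rewrite lo ?(andP jp).2 //; apply: lo1.
Qed.



(** * Cauchy-Schwarz and the triangle inequality for the tensor norm *)

Section Norms.
Variables (R : realType) (d : nat) (n : 'I_d -> nat).
Implicit Types (F H : midx n -> R).

Lemma tnorm_sq F : tnorm F ^+ 2 = \sum_(x : midx n) F x ^+ 2.
Proof. by rewrite sqr_sqrtr // sumr_ge0 // => x _; apply: sqr_ge0. Qed.

Lemma tnorm_ge0 F : 0 <= tnorm F.
Proof. exact: sqrtr_ge0. Qed.

Lemma tnorm_le F c : 0 <= c -> \sum_(x : midx n) F x ^+ 2 <= c ^+ 2 -> tnorm F <= c.
Proof. by move=> c0 Fc; rewrite -(ger0_norm c0) -sqrtr_sqr ler_wsqrtr. Qed.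

Lemma eq_tnorm F H : F =1 H -> tnorm F = tnorm H.
Proof. by move=> FH; congr Num.sqrt; apply: eq_bigr => x _; rewrite FH. Qed.

(** Discriminant argument: the squared norm of [H - t F] is a nonnegative quadratic in [t],
    evaluated at its minimiser [b / a]; if [a] is 0 then [F] vanishes. *)
Lemma cauchy_schwarz_sq F H :
  (\sum_(x : midx n) F x * H x) ^+ 2 <=
  (\sum_(x : midx n) F x ^+ 2) * (\sum_(x : midx n) H x ^+ 2).
Proof.
set a := \sum_(x : midx n) F x ^+ 2; set b := \sum_(x : midx n) F x * H x.
set c := \sum_(x : midx n) H x ^+ 2.
have quad t : 0 <= c - 2 * t * b + t ^+ 2 * a.
  rewrite (_ : _ + _ = \sum_(x : midx n) (H x - t * F x) ^+ 2).
    by apply: sumr_ge0 => x _; apply: sqr_ge0.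
  rewrite /a /b /c !mulr_sumr -sumrB -big_split; apply: eq_bigr => x _ /=; ring.
have a0 : 0 <= a by apply: sumr_ge0 => x _; apply: sqr_ge0.
case: (eqVneq a 0) => [a_eq0|aN0].
  rewrite a_eq0 mul0r (_ : b = 0) ?expr0n //.
  rewrite /b big1 // => x _; move/eqP: a_eq0.
  rewrite psumr_eq0 => [/allP/(_ x (mem_index_enum x))|y _]; last exact: sqr_ge0.
  by rewrite /= sqrf_eq0 => /eqP ->; rewrite mul0r.
have ap : 0 < a by rewrite lt_neqAle eq_sym aN0.
have := quad (b / a); rewrite -(pmulr_rge0 _ ap).
have -> : a * (c - 2 * (b / a) * b + (b / a) ^+ 2 * a) = a * c - b ^+ 2 by field.
by rewrite subr_ge0.
Qed.

Lemma tnormD F H : tnorm (fun x => F x + H x) <= tnorm F + tnorm H.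
Proof.
apply: tnorm_le; first by rewrite addr_ge0 ?tnorm_ge0.
rewrite sqrrD !tnorm_sq.
under eq_bigr => x _ do rewrite sqrrD.
rewrite !big_split /= lerD2r lerD2l -mulr2n lerMn2r /=.
apply: le_trans (ler_norm _) _.
rewrite -ler_sqr ?nnegrE ?mulr_ge0 ?tnorm_ge0 ?normr_ge0 //.
by rewrite real_normK ?num_real // exprMn !tnorm_sq cauchy_schwarz_sq.
Qed.

End Norms.

Theorem theorem4 (R : realType) (d : nat) (n : 'I_d -> nat) (A : midx n -> R)
    (p : nat) (eps : R) (G B : TT R) :
  (2 <= d)%N -> (1 <= p <= d)%N -> 0 <= eps ->
  sparse_tt A p G ->
  tt_round n eps p G B ->
  tnorm (fun x : midx n => A x - tt_eval B x) <= eps * tnorm A.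
Proof.
move=> d2 pd eps0 /(sparse_ttP d2 pd)[wG evG lG rG].
move=> [G1 [d1 [G2 [d3 [ch1 [ch2 ch3]]]]]].
rewrite (eq_tnorm evG) in ch1 ch3.
set sr := Num.sqrt (d - p)%:R in ch1 ch3.
set sl := Num.sqrt (p - 1)%:R in ch1 ch3.
have sr0 : 0 <= sr by apply: sqrtr_ge0.
have sl0 : 0 <= sl by apply: sqrtr_ge0.
(* As [d] is at least 2, [d - p] and [p - 1] are not both 0, so the weights of the two tolerances
   are well defined. *)
have s0 : 0 < sr + sl.
  have [pd'|pd'] := ltnP p d.
    by rewrite ltr_pwDl // sqrtr_gt0 ltr0n subn_gt0.
  by rewrite addrC ltr_pwDl // sqrtr_gt0 ltr0n; lia.
(* With an empty mode the error is an empty sum; otherwise all mode sizes are positive, as the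
   sweeps assume. *)
have [n0|nN0] := boolP [forall i, (0 < n i)%N]; last first.
  have [i] := forallPn nN0; rewrite -eqn0Ngt => /eqP ni.
  rewrite [X in X <= _](_ : _ = 0) ?mulr_ge0 ?tnorm_ge0 //.
  by rewrite /tnorm big1 ?sqrtr0 // => x _; case: (x i) => m; rewrite ni.
move/forallP: n0 => n0.
have pm : (p + (d - p))%N = d by lia.
have p0 : (0 < p)%N by lia.
have pm' : (p + (d - p) <= d)%N by lia.
have p1d : (p - 1 < d)%N by lia.
have [wG1 lo1 err1] := svd1_sweep n0 pm p0 wG lG rG ch1.
have [wG2 ev2 lo2 _ rG2] := qr_sweep pm' p0 wG1 ch2.
have lG2 j : (0 < j <= p - 1)%N -> lorth (G2 j).
  move=> jp; rewrite lo2; last by lia.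
  by rewrite lo1; [apply: lG; lia|lia].
have rG2' j : ((p - 1).+1 < j <= d)%N -> rorth (G2 j) by move=> jp; apply: rG2; lia.
have [wB _ err2] := svd2_sweep n0 p1d wG2 lG2 rG2' ch3.
(* [X] and [Y] are the errors of the two SVD-sweeps; they add up to the total error because the
   QR-sweep preserves the tensor. *)
pose X x := A x - tt_eval G1 x; pose Y (x : midx n) := tt_eval G2 x - tt_eval B x.
have -> : tnorm (fun x : midx n => A x - tt_eval B x) = tnorm (fun x => X x + Y x).
  by apply: eq_tnorm => x; rewrite /X /Y ev2; ring.
apply: le_trans (tnormD X Y) _.
have c0 : 0 <= eps * tnorm A by rewrite mulr_ge0 ?tnorm_ge0.
have -> : eps * tnorm A =
    sr / (sr + sl) * eps * tnorm A + sl / (sr + sl) * eps * tnorm A.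
  by field; lra.
apply: lerD; apply: tnorm_le;
  rewrite -?mulrA ?mulr_ge0 ?tnorm_ge0 ?invr_ge0 ?(ltW s0) //.
  by under eq_bigr => x _ do rewrite /X -evG; rewrite !mulrA.
by rewrite !mulrA.
Qed.
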